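(* Let $G$ be either $\mathrm{Homeo}(2^\omega)$ (the homeomorphism group of the Cantor space) or the automorphism group of the countably-infinite-dimensional vector space over a finite field. Then $S(G)$ and $E(M(G))$ are not isomorphic as $G$-ambits.
   Context: For a topological group $G$: a $G$-flow is a compact Hausdorff space with continuous right $G$-action; a $G$-ambit is a flow with a distinguished point of dense orbit. $S(G)$ is the Samuel compactification of $G$ with its left uniformity, the greatest ambit (distinguished point $1_G$). $M(G)$ is the universal minimal flow. For a flow $X$, $E(X)$ is the enveloping semigroup: the closure in $X^X$ of $\{x\mapsto xg:g\in G\}$, an ambit with distinguished point the identity map. $\mathrm{Homeo}(2^\omega)$ carries the compact-open topology and the vector space automorphism group the pointwise convergence topology. *)

(* Defs.v *)
From HB Require Import structures.
From mathcomp Require Import all_boot all_order all_algebra.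
From mathcomp Require Import all_classical all_reals all_analysis.
Set Implicit Arguments. Unset Strict Implicit. Unset Printing Implicit Defensive.
Import Order.TTheory GRing.Theory Num.Theory.
Local Open Scope classical_set_scope.
Local Open Scope ring_scope.

Section Generic.
Variables (G : topologicalType) (mul : G -> G -> G) (e : G).

Record is_flow (X : topologicalType) (act : X -> G -> X) : Prop := IsFlow {
  flow_compact : compact [set: X];
  flow_hausdorff : hausdorff_space X;
  flow_act1 : forall x, act x e = x;
  flow_actM : forall x g h, act (act x g) h = act x (mul g h);
  flow_cont : continuous (fun p : X * G => act p.1 p.2) }.

Lemma flow_cont_at (X : topologicalType) (act : X -> G -> X) :
  is_flow act -> forall g, continuous (act ^~ g).
Proof.
move=> [_ _ _ _ hc] g x.
apply: (@continuous_comp _ _ _ (fun y => (y, g)) (fun p : X * G => act p.1 p.2) x _ (hc (x, g))).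
by apply: cvg_pair; [exact: cvg_id | exact: cvg_cst].
Qed.

Definition is_ambit (X : topologicalType) (act : X -> G -> X) (x0 : X) :=
  is_flow act /\ closure (range (act x0)) = [set: X].

Definition ambit_morphism (X Y : topologicalType) (actX : X -> G -> X) (x0 : X)
    (actY : Y -> G -> Y) (y0 : Y) (f : X -> Y) :=
  [/\ continuous f, f x0 = y0 & forall x g, f (actX x g) = actY (f x) g].

Definition ambit_iso (X Y : topologicalType) (actX : X -> G -> X) (x0 : X)
    (actY : Y -> G -> Y) (y0 : Y) :=
  exists f : X -> Y, exists f' : Y -> X,
    [/\ ambit_morphism actX x0 actY y0 f, continuous f', cancel f f' & cancel f' f].

(** The greatest ambit: an ambit which maps (by a morphism of ambits) onto
    every ambit. S(G) is (up to isomorphism) the unique such ambit. *)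
Definition greatest_ambit (X : topologicalType) (act : X -> G -> X) (x0 : X) :=
  is_ambit act x0 /\
  forall (Y : topologicalType) (actY : Y -> G -> Y) (y0 : Y),
    is_ambit actY y0 -> exists f : X -> Y, ambit_morphism act x0 actY y0 f.

Definition minimal_flow (X : topologicalType) (act : X -> G -> X) :=
  [/\ is_flow act, [set: X] !=set0 & forall x : X, closure (range (act x)) = [set: X]].

Definition universal_minimal_flow (X : topologicalType) (act : X -> G -> X) :=
  minimal_flow act /\
  forall (Y : topologicalType) (actY : Y -> G -> Y), minimal_flow actY ->
    exists f : X -> Y, [/\ continuous f, (forall y, exists x, f x = y) &
                          forall x g, f (act x g) = actY (f x) g].

Definition env_set (X : topologicalType) (act : X -> G -> X) : set {ptws X -> X} :=
  closure (range (fun g : G => (act ^~ g : {ptws X -> X}))).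

Definition Env (X : topologicalType) (act : X -> G -> X) : topologicalType :=
  set_type (env_set act).


Lemma ptws_continuous (Y Z : topologicalType) (I : Type) (h : Y -> {ptws I -> Z}) :
  (forall i, continuous (fun y => h y i)) -> continuous h.
Proof.
move=> hc y.
apply/cvg_sup => i.
have H := @continuous_comp_initial {ptws I -> Z} Y Z (fun f => f i) h (hc i).
exact: H.
Qed.

Lemma env_set_act (X : topologicalType) (act : X -> G -> X) (hX : is_flow act)
  (p : {ptws X -> X}) (g : G) :
  env_set act p -> env_set act ((fun x => act (p x) g) : {ptws X -> X}).
Proof.
set k := fun q : {ptws X -> X} => ((fun x => act (q x) g) : {ptws X -> X}).
have kc : continuous k.
  apply: ptws_continuous => i q.
  apply: (@continuous_comp _ _ _ (fun q : {ptws X -> X} => q i) (act ^~ g)).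
    exact: proj_continuous.
  exact: flow_cont_at.
move=> Ep.
have cl : closed (k @^-1` env_set act).
  by apply: preimage_closed; [move=> ? _; exact: kc | exact: closed_closure].
have sub : range (fun h : G => (act ^~ h : {ptws X -> X})) `<=` k @^-1` env_set act.
  move=> q [h _ <-]; apply: subset_closure; exists (mul h g) => //.
  by apply: funext => x; rewrite /k /= flow_actM.
have := closureS sub Ep.
by rewrite -(proj1 (closure_id _) cl).
Qed.

Definition Env_act (X : topologicalType) (act : X -> G -> X) (hX : is_flow act)
  (p : Env act) (g : G) : Env act :=
  exist _ ((fun x => act (sval p x) g) : {ptws X -> X})
    (mem_set (@env_set_act X act hX (sval p) g (set_mem (svalP p)))).

Lemma env_set_id (X : topologicalType) (act : X -> G -> X) (hX : is_flow act) :
  env_set act (id : {ptws X -> X}).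
Proof.
apply: subset_closure; exists e => //.
by apply: funext => x; rewrite flow_act1.
Qed.

Definition Env_base (X : topologicalType) (act : X -> G -> X) (hX : is_flow act) :
  Env act := exist _ (id : {ptws X -> X}) (mem_set (env_set_id hX)).

End Generic.

Lemma umf_is_flow (G : topologicalType) (mul : G -> G -> G) (e : G)
  (X : topologicalType) (act : X -> G -> X) :
  universal_minimal_flow mul e act -> is_flow mul e act.
Proof. by case=> -[]. Qed.

(** "S(G) and E(M(G)) are not isomorphic as G-ambits", for the topological
    group G with multiplication [mul] and identity [e]: for any greatest ambit
    (S, s0) (= the Samuel compactification S(G) with base point 1_G, unique up
    to isomorphism) and any universal minimal flow M (= M(G), unique up to
    isomorphism), the ambits (S, s0) and (E(M), id) are not isomorphic. *)
Definition S_not_iso_EM (G : topologicalType) (mul : G -> G -> G) (e : G) : Prop :=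
  forall (S : topologicalType) (actS : S -> G -> S) (s0 : S),
    greatest_ambit mul e actS s0 ->
  forall (M : topologicalType) (actM : M -> G -> M)
         (hM : universal_minimal_flow mul e actM),
    ~ ambit_iso actS s0 (Env_act (umf_is_flow hM)) (Env_base (umf_is_flow hM)).

Definition homeo_set : set {compact-open, cantor_space -> cantor_space} :=
  [set f | continuous (f : cantor_space -> cantor_space) /\
           exists g : cantor_space -> cantor_space,
             [/\ continuous g, cancel f g & cancel g f]].

Definition Homeo : topologicalType := set_type homeo_set.

Lemma homeo_set_comp (f g : Homeo) :
  homeo_set ((sval f \o sval g : cantor_space -> cantor_space)
              : {compact-open, cantor_space -> cantor_space}).
Proof.
move: (svalP f) (svalP g) => /set_mem [fc [f' [f'c ff' f'f]]].
move=> /set_mem [gc [g' [g'c gg' g'g]]] /=.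
split; first by move=> x; apply: continuous_comp; [exact: gc | exact: fc].
exists (g' \o f'); split.
- by move=> x; apply: continuous_comp; [exact: f'c | exact: g'c].
- by move=> x /=; rewrite ff' gg'.
- by move=> x /=; rewrite g'g f'f.
Qed.

Definition homeo_mul (f g : Homeo) : Homeo :=
  exist (fun x => x \in homeo_set) _ (mem_set (homeo_set_comp f g)).

Lemma homeo_set_id :
  homeo_set ((id : cantor_space -> cantor_space)
              : {compact-open, cantor_space -> cantor_space}).
Proof.
split; first by move=> x; exact: cvg_id.
by exists id; split => // x; exact: cvg_id.
Qed.

Definition homeo_id : Homeo := exist (fun x => x \in homeo_set) _ (mem_set homeo_set_id).

(** * GL(V), V the countably-infinite-dimensional vector space over a finite
    field F, with the topology of pointwise convergence (V discrete).
    V is realized as the F-vector space of polynomials {poly F}, which has the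
    countably infinite basis 1, X, X^2, ... *)
Definition aut_set (F : finFieldType) :
  set {ptws {poly F} -> discrete_topology {poly F}} :=
  [set f | (forall (a : F) (u v : {poly F}),
              (f (a *: u + v) : {poly F}) = a *: (f u : {poly F}) + f v)
           /\ bijective (f : {poly F} -> {poly F})].

Definition Aut (F : finFieldType) : topologicalType := set_type (@aut_set F).

Lemma aut_set_comp (F : finFieldType) (f g : Aut F) :
  @aut_set F ((sval f \o sval g : {poly F} -> {poly F})
              : {ptws {poly F} -> discrete_topology {poly F}}).
Proof.
move: (svalP f) (svalP g) => /set_mem [fl fb] /set_mem [gl gb] /=.
split; last exact: bij_comp.
by move=> a u v /=; rewrite gl fl.
Qed.

Definition aut_mul (F : finFieldType) (f g : Aut F) : Aut F :=
  exist (fun x => x \in @aut_set F) _ (mem_set (aut_set_comp f g)).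

Lemma aut_set_id (F : finFieldType) :
  @aut_set F ((id : {poly F} -> {poly F})
              : {ptws {poly F} -> discrete_topology {poly F}}).
Proof. by split => //; exists id. Qed.

Definition aut_id (F : finFieldType) : Aut F := exist (fun x => x \in @aut_set F) _ (mem_set (aut_set_id F)).

(* Main.v *)
Require Import Defs.
From HB Require Import structures.
From mathcomp Require Import all_boot all_order all_algebra.
From mathcomp Require Import all_classical all_reals all_analysis.
From mathcomp Require Import Rstruct lra zify.
Set Implicit Arguments. Unset Strict Implicit. Unset Printing Implicit Defensive.
Import Order.TTheory GRing.Theory Num.Theory.
Import numFieldNormedType.Exports.

(** If [S(G)] and [E(M)] were isomorphic, then [E(M)] would map onto every ambit,
    in particular onto the orbit closure of a suitable locally constant test
    [T : G -> bool]. By compactness, [T g] would then be determined, up to a fixed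
    error, by finitely many observations [f i (x i g)] with [x i] in [M] and
    [f i] continuous. By minimality of [M] all [x i] can be approached from a
    single orbit, so that this contradicts the following combinatorial fact: every
    finite colouring of [G] at a given resolution can be translated so that,
    from any finitely many viewpoints [a i], it fails to distinguish two elements
    that [T] does distinguish.

    Elements of [G] at a given resolution are labellings of a finite set by a
    finite set [X] (a clopen partition, resp. a matrix read row by row).
    The Hales-Jewett theorem yields a translate for which the colour of a
    labelling of a linearly ordered set depends only on an initial segment meeting
    all labels. Only boundedly many places are thereby observed, and [T] (the
    parity of a number of labels, resp. the vanishing of a hyperbolic quadratic
    form) can be changed outside them. *)

(** * The Hales-Jewett theorem and its consequence for surjective words *)

(** Words over [option A] encode combinatorial lines, [None] marking the variable coordinates. *)
Definition fill (A : Type) (a : A) (V : seq (option A)) : seq A :=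
  [seq odflt a o | o <- V].

Section HalesJewett.
Variable A : finType.

Definition monochromatic (C : Type) (c : seq A -> C) (B : seq A) V :=
  None \in V /\ {in B &, forall a b, c (fill a V) = c (fill b V)}.

Definition hj_length (C : Type) (B : seq A) (L : nat) :=
  forall c : seq A -> C, exists2 V, size V = L & monochromatic c B V.

(** The colour-focused families of the classical proof: [z] is the letter being added to [B], [f] is
    the common endpoint of the lines at [z], and colours on [B] are read at the reference letter
    [b0]. *)
Definition focused (C : eqType) (c : seq A -> C) (z b0 : A) (B : seq A) L Ss f :=
  [/\ all (fun V => size V == L) Ss,
      {in Ss, forall V, [/\ None \in V, fill z V = f &
                          {in B, forall a, c (fill a V) = c (fill b0 V)}]}
    & uniq [seq c (fill b0 V) | V <- Ss]].

(** Every round either completes a line over [z :: B] or gains one focused line. The [L'] new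
    coordinates are coloured by the entire induced colouring of the [L] old ones, so a line [U]
    found there can be appended to any old word with no effect on colours as its variable runs over
    [B]. *)
Lemma hj_focusing (C : finType) (z b0 : A) (B : seq A) :
    b0 \in B -> (forall D : finType, exists L, hj_length D B L) ->
  forall s, exists L, forall c : seq A -> C,
    (exists2 V, size V = L & monochromatic c (z :: B) V) \/
    (exists Ss f, size Ss = s /\ focused c z b0 B L Ss f).
Proof.
move=> b0B hjB; elim=> [|s [L hL]].
  by exists 0 => c; right; exists [::], [::]; split=> //; split.
have [L' hL'] := hjB {ffun L.-tuple A -> C}.
exists (L + L') => c.
have [U sV [nV mV]] := hL' (fun w => [ffun u : L.-tuple A => c (u ++ w)]).
have mV' u a b : size u = L -> a \in B -> b \in B ->
    c (u ++ fill a U) = c (u ++ fill b U).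
  move=> /eqP su aB bB; have := mV a b aB bB.
  by move=> /ffunP /(_ (Tuple su)); rewrite !ffunE.
pose c' u := c (u ++ fill b0 U).
have line V : size V = L -> monochromatic c' (z :: B) V ->
    exists2 V', size V' = L + L' & monochromatic c (z :: B) V'.
  move=> sS [nS mS]; exists (V ++ [seq Some x | x <- fill b0 U]).
    by rewrite size_cat sS !size_map sV.
  split; first by rewrite mem_cat nS.
  move=> a b aB bB; have := mS a b aB bB; rewrite /c' /fill !map_cat -!map_comp.
  by rewrite (@eq_map _ _ (odflt a \o some \o odflt b0) (odflt b0)) //
             (@eq_map _ _ (odflt b \o some \o odflt b0) (odflt b0)).
have [[V sS mS]|[Ss [f [sSs [szS fS uS]]]]] := hL c'.
  by left; exact: line mS.
(* If the focus shares the colour of some line, that line stays monochromatic with [z] added.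
   Otherwise the focus followed by [U] is a line of a new colour. *)
have [/mapP[V VSs cf]|cf] := boolP (c' f \in [seq c' (fill b0 V) | V <- Ss]).
  left; apply: (line V); first exact/eqP/(allP szS).
  have [nS zS mS] := fS _ VSs; split=> // a b.
  have h x : x \in z :: B -> c' (fill x V) = c' (fill b0 V).
    by rewrite inE => /predU1P[->|/mS//]; rewrite zS.
  by move=> /h-> /h->.
(* An empty family does not constrain the length of [f]; a constant prefix of length [L] then
   replaces it. *)
have [Ss0|sf] : Ss = [::] \/ size f = L.
  case: Ss {sSs uS cf} szS fS => [|V Ss]; [by left|right].
  by move: szS => /= /andP[/eqP<- _]; have [_ <- _] := fS V (mem_head _ _); rewrite size_map.
  right; exists [:: nseq L (Some b0) ++ U], (nseq L b0 ++ fill z U).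
  split; first by rewrite -sSs Ss0.
  have e x : fill x (nseq L (Some b0) ++ U) = nseq L b0 ++ fill x U.
    by rewrite /fill map_cat map_nseq.
  split=> //=; first by rewrite size_cat size_nseq sV eqxx.
  move=> V; rewrite inE => /eqP->; split; rewrite ?mem_cat ?nV ?orbT ?e //.
  by move=> a aB; rewrite !e (mV' _ _ b0) ?size_nseq.
right; exists ((map Some f ++ U) :: [seq V ++ U | V <- Ss]), (f ++ fill z U).
split; first by rewrite /= size_map sSs.
have e x : fill x (map Some f ++ U) = f ++ fill x U.
  by rewrite /fill map_cat -map_comp map_id.
have e' x V : fill x (V ++ U) = fill x V ++ fill x U by rewrite /fill map_cat.
split.
- rewrite /= size_cat size_map sf sV eqxx /= all_map; apply/allP => V VSs /=.
  by rewrite size_cat (eqP (allP szS _ VSs)) sV.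
- move=> V; rewrite inE => /predU1P[->|/mapP[V' V'Ss ->]].
    split; rewrite ?mem_cat ?nV ?orbT ?e //.
    by move=> a aB; rewrite !e (mV' _ _ b0).
  have [nS zS mS] := fS _ V'Ss; have sS := eqP (allP szS _ V'Ss).
  split; rewrite ?mem_cat ?nV ?orbT ?e' ?zS //.
  move=> a aB; rewrite !e' (mV' _ _ b0) ?size_map //; exact: mS.
- rewrite /= e -map_comp.
  rewrite (@eq_map _ _ _ (fun V => c' (fill b0 V))) ?uS ?andbT //.
  by move=> V /=; rewrite e'.
Qed.

(** Induction on the alphabet with [C] left arbitrary, because focusing applies the smaller alphabet
    to product colours. The alternative of [#|C|.+1] focused lines contradicts the pigeonhole
    principle. *)
Lemma hales_jewett (C : finType) : exists L, hj_length C (enum A) L.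
Proof.
elim: (enum A) C => [|z [|b0 B] IH] C.
- by exists 1 => c; exists [:: None].
- exists 1 => c; exists [:: None] => //; split=> // a b.
  by rewrite !inE => /eqP-> /eqP->.
have [L hL] := hj_focusing C z (mem_head b0 B) IH #|C|.+1.
exists L => c; have [//|[Ss [f [sSs [_ _ uS]]]]] := hL c.
by have := max_card [in map (fun V => c (fill b0 V)) Ss];
  rewrite (card_uniqP uS) size_map sSs ltnn.
Qed.

End HalesJewett.

(* Induction on [m]: the new letter of [W] is the variable of a
   Hales--Jewett line over the alphabet of earlier positions; since the earlier
   letters already take all values of [X], the value at the new letter is always
   one of those the line is monochromatic for. *)
Lemma ramsey_words (X C : finType) (x0 : X) (m : nat) :
  exists N, forall c : seq X -> C, exists W : seq 'I_m,
    [/\ size W = N, forall i, i \in W &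
      forall (b b' : 'I_m -> X) (j : nat),
      (forall i : 'I_m, i < j -> b i = b' i) ->
      (forall x, exists2 i : 'I_m, i < j & b i = x) ->
      c (map b W) = c (map b' W)].
Proof.
elim: m => [|m [N hN]].
  exists 0 => c; exists [::]; split=> // -[//].
have [L hL] := hales_jewett 'I_N {ffun N.-tuple X -> C}.
exists (N + L) => c.
(* [V] is a line whose alphabet is the set of positions of [w]: a constant reads [w] at that
   position, the variable reads [y]. *)
pose ev (w : seq X) (y : X) (V : seq (option 'I_N)) :=
  [seq (if o is Some p then nth x0 w (nat_of_ord p) else y) | o <- V].
have [V sV [nV mV]] :=
  hL (fun s => [ffun w : N.-tuple X => c (w ++ [seq nth x0 w (nat_of_ord p) | p <- s])]).
have evE w (p : 'I_N) : [seq nth x0 w (nat_of_ord q) | q <- fill p V] = ev w (nth x0 w p) V.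
  by rewrite -map_comp; apply: eq_map => -[].
(* As [y] occurs in [w], it is the value read at position [index y w]; the line is monochromatic,
   and position 0 serves as reference. *)
have cE w y : size w = N -> y \in w -> c (w ++ ev w y V) = c (w ++ ev w (nth x0 w 0) V).
  move=> sw yw; have N0 : 0 < N by rewrite -sw; case: w yw {sw}.
  have yN : index y w < N by rewrite -sw index_mem.
  have := mV (Ordinal yN) (Ordinal N0) (mem_enum _ _) (mem_enum _ _).
  move/eqP: sw => sw /ffunP/(_ (Tuple sw)); rewrite !ffunE /= !evE /=.
  by rewrite nth_index.
have [W [sW onW hW]] := hN (fun w => c (w ++ ev w (nth x0 w 0) V)).
pose inj (i : 'I_m) : 'I_m.+1 := widen_ord (leqnSn m) i.
pose letter (o : option 'I_N) : 'I_m.+1 :=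
  if o is Some p then nth ord_max (map inj W) p else ord_max.
exists (map inj W ++ map letter V); split.
- by rewrite size_cat !size_map sW sV.
- move=> i; rewrite mem_cat; have [im|mi] := ltnP i m.
    apply/orP; left; apply/mapP; exists (Ordinal im); last exact: val_inj.
    exact: onW.
  apply/orP; right; apply/mapP; exists None => //; apply: val_inj => /=.
  by apply/eqP; rewrite eqn_leq mi -ltnS ltn_ord.
move=> b b' j bb' bsurj.
have mapE (f : 'I_m.+1 -> X) :
    map f (map inj W ++ map letter V) =
    map (f \o inj) W ++ ev (map (f \o inj) W) (f ord_max) V.
  rewrite map_cat -!map_comp; congr cat; apply: eq_map => -[p|] //=.
  by rewrite [map (_ \o _) W]map_comp (nth_map ord_max) ?size_map ?sW.
(* For [m < j] the two labellings coincide. For [j <= m] all values of [X] already occur on old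
   letters, so [cE] removes the value at [ord_max] from the colour. *)
have [jm|mj] := leqP j m; last first.
  congr c; apply: eq_map => i; apply: bb'; exact: leq_trans (ltn_ord i) mj.
have onb (f : 'I_m.+1 -> X) : (forall i : 'I_m.+1, i < j -> b i = f i) ->
    forall x, x \in map (f \o inj) W.
  move=> bf x; have [i ij <-] := bsurj x; rewrite bf //.
  apply/mapP; exists (Ordinal (leq_trans ij jm)) => //=; congr f; exact: val_inj.
rewrite !mapE !cE ?size_map ?onb //.
apply: (hW _ _ j) => [i ij|x] /=; first exact: bb'.
have [i ij <-] := bsurj x; exists (Ordinal (leq_trans ij jm)) => //=.
congr b; exact: val_inj.
Qed.

Definition prefix_image (Z : finType) (m : nat) (s : 'I_m -> Z) (j : nat) : {set Z} :=
  [set s i | i : 'I_m & i < j].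

Lemma prefix_imageP (Z : finType) (m : nat) (s : 'I_m -> Z) (j : nat) (z : Z) :
  reflect (exists2 i : 'I_m, i < j & s i = z) (z \in prefix_image s j).
Proof.
apply: (iffP imsetP) => [[i]|[i ij <-]]; first by rewrite inE => ij ->; exists i.
by exists i; rewrite ?inE.
Qed.

(** A discrete intermediate value argument: as [j] grows, the image gains at most one element at a
    time until it exhausts [Z]. *)
Lemma prefix_image_card (Z : finType) (m : nat) (s : 'I_m -> Z) (J : nat) :
    (forall z, exists i, s i = z) -> J <= #|Z| ->
  exists j, #|prefix_image s j| = J.
Proof.
move=> sS JZ; pose I := prefix_image s.
have IS j : #|I j.+1| <= #|I j|.+1.
  have [jm|mj] := ltnP j m.
    apply: leq_trans (_ : #|s (Ordinal jm) |: I j| <= _); last first.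
      by rewrite cardsU1 -add1n leq_add2r; case: (_ \notin _).
    apply/subset_leq_card/fintype.subsetP => z /imsetP[i]; rewrite inE ltnS leq_eqVlt.
    case/predU1P => [ij|ij] ->; rewrite inE.
      by apply/orP; left; rewrite inE; apply/eqP; congr s; exact: val_inj.
    by apply/orP; right; apply: imset_f; rewrite inE.
  apply/leqW/subset_leq_card/fintype.subsetP => z /imsetP[i _ ->].
  by apply: imset_f; rewrite inE (leq_trans (ltn_ord i)).
have Im : #|I m| = #|Z|.
  rewrite -cardsT; congr #|pred_of_set _|; apply/setP => z; rewrite inE.
  by have [i <-] := sS z; apply: imset_f; rewrite inE.
have exJ : exists j, J <= #|I j| by exists m; rewrite Im.
have [j Jj jmin] := ex_minnP exJ.
exists j; apply/eqP; rewrite eqn_leq Jj andbT.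
case: j Jj jmin => [|j] Jj jmin.
  rewrite (_ : prefix_image s 0 = finset.set0) ?cards0 //; apply/setP => z.
  by rewrite inE; apply/imsetP => -[i]; rewrite inE.
apply: leq_trans (IS j) _; rewrite ltnNge; apply/negP => /jmin.
by rewrite ltnn.
Qed.

Local Open Scope classical_set_scope.
Local Open Scope ring_scope.

(** * Orbit closures and the dynamical criterion *)

Lemma near_seq (T : Type) (I : eqType) (s : seq I) (F : set_system T)
    (P : I -> T -> Prop) : Filter F ->
  (forall i, i \in s -> \forall t \near F, P i t) ->
  \forall t \near F, forall i, i \in s -> P i t.
Proof.
move=> FF; elim: s => [|i s IH] Ps; first by apply: nearW => t i; rewrite in_nil.
have Pi := Ps i (mem_head _ _).
have {}IH : \forall t \near F, forall j, j \in s -> P j t.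
  by apply: IH => j js; apply: Ps; rewrite inE js orbT.
by apply: filterS2 Pi IH => t Pit IHt j; rewrite inE => /predU1P[->|/IHt].
Qed.

Lemma closure_stable (X : topologicalType) (k : X -> X) (A : set X) :
  continuous k -> (forall x, A x -> A (k x)) -> forall x, closure A x -> closure A (k x).
Proof.
move=> kc kA x Ax U /kc kU; have [y [Ay Uy]] := Ax _ kU.
by exists (k y); split=> //; exact: kA.
Qed.

(** * Topology of subspaces *)

Section SetType.
Variables (X : topologicalType) (A : set X).

Lemma nbhs_set_type (x : A) (U : set A) :
  nbhs x U <-> exists2 V, nbhs (sval x) V & forall y : A, V (sval y) -> U y.
Proof.
split=> [[_ [/= [W oW <-]] /= Wx WU]|[V Vx VU]].
  by exists W => //; apply: open_nbhs_nbhs; split.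
apply: filterS VU _; exact: (@initial_continuous A X set_val x V Vx).
Qed.

Lemma compact_set_type : compact A -> compact [set: A].
Proof.
move=> cA F PF _.
have PsF : ProperFilter (sval @ F) by exact: fmap_proper_filter.
have FA : \forall x \near F, A (sval x) by apply: filterE => x; exact: set_mem (svalP x).
have [x [Ax clx]] := cA _ PsF FA.
exists (exist _ x (mem_set Ax)); split=> // B C FB /nbhs_set_type[V Vx VC].
have sFB : \forall y \near F, (sval @` B) (sval y) by apply: filterS FB => y By; exists y.
have [_ [[y By <-] Vy]] := clx _ _ sFB Vx.
by exists y; split=> //; exact: VC.
Qed.

Lemma hausdorff_set_type : hausdorff_space X -> hausdorff_space A.
Proof.
move=> hX x y cxy; apply: eq_sig_hprop; first by move=> *; exact: Prop_irrelevance.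
apply: hX => U V Ux Vy; have [] := cxy (sval @^-1` U) (sval @^-1` V).
- by apply/nbhs_set_type; exists U.
- by apply/nbhs_set_type; exists V.
by move=> z [Uz Vz]; exists (sval z).
Qed.

Lemma continuous_set_type (Y : topologicalType) (f : Y -> A) :
  continuous (fun y => sval (f y)) -> continuous f.
Proof.
move=> fc y U /nbhs_set_type[V Vy VU].
have fV : \forall z \near y, V (sval (f z)) := fc y V Vy.
by change (\forall z \near y, U (f z)); apply: filterS fV => z; exact: VU.
Qed.

End SetType.

Lemma ptws_cvg (I : Type) (Z : topologicalType) (F : set_system {ptws I -> Z})
    (f : {ptws I -> Z}) : Filter F ->
  (forall i U, nbhs (f i) U -> \forall g \near F, U (g i)) -> F --> f.
Proof.
move=> FF Ff; apply/cvg_sup => i U [_ [[V oV <-] Vf VU]].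
by apply: filterS VU _; apply: Ff; apply: open_nbhs_nbhs.
Qed.

(** * The orbit closure of a locally constant test, as an ambit *)

Section OrbitClosure.
Variables (G : topologicalType) (mul : G -> G -> G) (e : G).
Hypotheses (mulA : associative mul) (mul1g : left_id e mul).
Variable T : G -> bool.
Hypothesis T_loc : forall g x, \forall g' \near g,
  forall a, T (mul a (mul g' x)) = T (mul a (mul g x)).

Let B := {ptws G -> bool}.

Definition shift (t : B) (g : G) : B := fun x => t (mul g x).

Lemma nbhs_eval (t : B) x : \forall s \near t, s x = t x.
Proof.
have := @proj_continuous G (fun=> bool) x t [set t x].
by apply; exact: discrete_set1.
Qed.

Lemma shift_continuous g : continuous (fun t => shift t g).
Proof. by apply: ptws_continuous => x t; exact: proj_continuous. Qed.

Lemma shiftM t g h : shift (shift t g) h = shift t (mul g h).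
Proof. by apply: funext => x; rewrite /shift mulA. Qed.

Definition orbit_closure : set B := closure (range (shift (T : B))).

Lemma orbit_closure_shift t g : orbit_closure t -> orbit_closure (shift t g).
Proof.
apply: (@closure_stable B (fun s => shift s g)); first exact: shift_continuous.
by move=> _ [h _ <-]; exists (mul h g); rewrite ?shiftM.
Qed.

(** [T_loc] is uniform in the left factor [a], hence holds for all shifts of [T] at once; agreement
    at two given points is a closed condition and passes to limits. *)
Lemma orbit_closure_loc g x : \forall g' \near g,
  forall t, orbit_closure t -> t (mul g' x) = t (mul g x).
Proof.
apply: filterS (T_loc g x) => g' Tg' t /(_ _ (filterI (nbhs_eval t (mul g' x))
  (nbhs_eval t (mul g x)))) [_ [[a _ <-]]] [<- <-].
exact: Tg'.
Qed.

Definition orbit_act (t : orbit_closure) (g : G) : orbit_closure :=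
  exist _ (shift (sval t) g)
    (mem_set (@orbit_closure_shift (sval t) g (set_mem (svalP t)))).

Lemma shift1 t : shift t e = t.
Proof. by apply: funext => x; rewrite /shift mul1g. Qed.

Lemma orbit_base_subproof : orbit_closure (T : B).
Proof. by apply: subset_closure; exists e; rewrite ?shift1. Qed.

Definition orbit_base : orbit_closure :=
  exist _ (T : B) (mem_set orbit_base_subproof).

Lemma orbit_closure_ambit : is_ambit mul e orbit_act orbit_base.
Proof.
have Pirr (p : B) (x y : p \in orbit_closure) : x = y by exact: Prop_irrelevance.
split.
  split.
  - apply: compact_set_type.
    apply: (@subclosed_compact B _ setT); [exact: closed_closure| |by []].
    have := @tychonoff G (fun=> bool) _ (fun=> bool_compact).
    by congr (compact _); rewrite eqEsubset.
  - apply: hausdorff_set_type; apply: hausdorff_product => _.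
    exact: discrete_hausdorff.
  - by move=> t; apply: eq_sig_hprop => //=; exact: shift1.
  - by move=> t g h; apply: eq_sig_hprop => //=; exact: shiftM.
  (* Joint continuity: near [g] the evaluation point [mul g x] can be frozen uniformly over the
     orbit closure, and near [t] the value there is constant. *)
  - apply: continuous_set_type; apply: ptws_continuous => x [t g] U /= Ut.
    have tn : \forall s \near t, sval s (mul g x) = sval t (mul g x).
      by apply/nbhs_set_type; eexists; first exact: (nbhs_eval (sval t) (mul g x)).
    exists ([set s | sval s (mul g x) = sval t (mul g x)],
      [set g' | forall t, orbit_closure t -> t (mul g' x) = t (mul g x)]).
      by split; [exact: tn | exact: orbit_closure_loc].
    move=> [s g'] /= [sx g'x]; rewrite /shift g'x; last exact: set_mem (svalP s).
    by rewrite sx; exact: nbhs_singleton.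
rewrite -subTset => t _ U /nbhs_set_type[V Vt VU].
have [_ [[g _ <-] Vg]] := set_mem (svalP t) V Vt.
by exists (orbit_act orbit_base g); split; [exists g | exact: VU].
Qed.

End OrbitClosure.

Lemma compact_finite_subcover (X : topologicalType) (I : eqType) (A : set X)
    (D : set I) (f : I -> set X) : compact A -> (forall i, D i -> open (f i)) ->
  (forall x, A x -> exists2 i, D i & f i x) ->
  exists2 s : seq I, forall i, i \in s -> D i &
    forall x, A x -> exists2 i, i \in s & f i x.
Proof.
move=> /compact_near_coveringP cA fo Af.
(* The near-covering form of compactness is applied along the filter of finite lists directed by
   inclusion. *)
pose F : set_system (seq I) :=
  [set P | exists s0 : seq I, forall s, {subset s0 <= s} -> P s].
have FF : Filter F.
  split; first by exists [::].
    move=> P Q [s0 Ps] [s1 Qs]; exists (s0 ++ s1) => s ss; split.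
      by apply: Ps => i i0; apply: ss; rewrite mem_cat i0.
    by apply: Qs => i i0; apply: ss; rewrite mem_cat i0 orbT.
  by move=> P Q PQ [s0 Ps]; exists s0 => s /Ps /PQ.
have [x Ax|s0 /(_ s0 (fun _ => id)) sA] :=
    cA _ F (fun s x => exists i, [/\ i \in s, D i & f i x]) FF.
  have [i Di fix_] := Af x Ax; exists (f i, [set s | i \in s]).
    split=> /=; first by apply: open_nbhs_nbhs; split=> //; exact: fo.
    by exists [:: i] => s; apply; rewrite mem_head.
  by move=> [y s] [/= fiy si]; exists i.
exists [seq i <- s0 | `[< D i >]] => [i|x /sA[i [si Di fix_]]].
  by rewrite mem_filter => /andP[/asboolP].
by exists i => //; rewrite mem_filter si andbT; apply/asboolP.
Qed.

(** Return times to [O] are syndetic: every orbit is dense, so the preimages of the interior of [O]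
    under the group cover [M], and finitely many suffice. *)
Lemma minimal_syndetic (G : topologicalType) (mul : G -> G -> G) (e : G)
    (M : topologicalType) (act : M -> G -> M) (x : M) (O : set M) :
  minimal_flow mul e act -> nbhs x O ->
  exists s : seq G, forall y, exists2 a, a \in s & O (act y a).
Proof.
move=> [hM _ dense] Ox; have [cM _ _ _ _] := hM.
have [||s _ covD] := @compact_finite_subcover M G setT setT
  (fun a => (act ^~ a) @^-1` O^°) cM.
- move=> a _; apply: open_comp (open_interior O) => y _.
  exact: (flow_cont_at hM).
- move=> y _.
  have yx : closure (range (act y)) x by rewrite dense.
  have [_ [[a _ <-] Oa]] := yx O^° (nbhs_interior Ox).
  by exists a.
exists s => y; have [a sa Oa] := covD y I.
by exists a => //; exact: interior_subset Oa.
Qed.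

(** Joint continuity at each [(y, e)] becomes uniform in [y] by compactness of [M]. *)
Lemma flow_equicontinuous (R : realType) (G : topologicalType)
    (mul : G -> G -> G) (e : G) (M : topologicalType) (act : M -> G -> M)
    (f : M -> R) (d : R) : is_flow mul e act -> continuous f -> 0 < d ->
  \forall u \near e, forall y, `|f (act y u) - f y| < d.
Proof.
move=> [cM _ act1 _ actc] fc d0.
have /compact_near_coveringP ncM := cM.
suff : \forall u \near e, [set: M] `<=` [set y | `|f (act y u) - f y| < d].
  by apply: filterS => u Pu y; exact: Pu.
apply: (ncM G (nbhs e) (fun u y => `|f (act y u) - f y| < d)) => y _.
have k : (fun p : M * G => f (act p.1 p.2) - f p.1) @ (y, e) --> f (act y e) - f y.
  apply: cvgB.
    exact: (continuous_comp (actc (y, e)) (fc _)).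
  apply: (@continuous_comp _ _ _ fst f (y, e) _ (fc _)); exact: cvg_fst.
rewrite act1 subrr in k.
move/cvgrPdist_lt: k => /(_ d d0); apply: filterS => -[y' u] /=.
by rewrite sub0r normrN.
Qed.

(** * Finite determination of clopen sets in the enveloping semigroup *)

Section Separation.
Variables (R : realType) (G : topologicalType) (mul : G -> G -> G) (e : G).
Variables (M : topologicalType) (act : M -> G -> M) (hM : is_flow mul e act).

Lemma Env_compact : compact [set: Env act].
Proof.
apply: compact_set_type; apply: (@subclosed_compact _ _ setT).
- exact: closed_closure.
- have := @tychonoff M (fun=> M) _ (fun=> flow_compact hM).
  by congr (compact _); rewrite eqEsubset.
- by [].
Qed.

Lemma Env_eval_continuous (x : M) : continuous (fun p : Env act => sval p x).
Proof.
move=> p; apply: (@continuous_comp _ _ _ (sval : Env act -> _) (fun q : {ptws M -> M} => q x)).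
  exact: initial_continuous.
exact: proj_continuous.
Qed.

(** Elements separated by [psi] differ at some point of [M], and a Urysohn function tells the two
    values apart. The pairs separated by [psi] form a compact set, so finitely many such
    observations detect all of them. *)
Lemma Env_finite_determination (x0 : M) (psi : Env act -> bool) : continuous psi ->
  exists (I : finType) (i0 : I) (x : I -> M) (f : I -> M -> R),
    [/\ forall i, continuous (f i), forall i y, 0 <= f i y <= 1 &
      forall p q : Env act,
        (forall i, `|f i (sval p (x i)) - f i (sval q (x i))| < 2^-1) ->
        psi p = psi q].
Proof.
move=> psic; pose E := Env act.
have urysohn (y z : M) : y <> z -> exists f : M -> R,
    [/\ continuous f, forall w, 0 <= f w <= 1, f y = 0 & f z = 1].
  move=> yz; have nM := compact_normal (flow_hausdorff hM) (flow_compact hM).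
  have cl w : closed [set w : M].
    exact/accessible_closed_set1/hausdorff_accessible/(flow_hausdorff hM).
  have yz0 : [set y] `&` [set z] = set0 by rewrite -subset0 => _ [-> /yz].
  have sep := normal_uniform_separator nM (cl y) (cl z) yz0.
  have [f [fc f01 fy fz]] := (@uniform_separatorP M R _ _).1 sep.
  exists f; split=> //; last 2 first.
  - by apply: fy; exists y.
  - by apply: fz; exists z.
  - by move=> w; have := f01 (f w) (ex_intro2 _ _ w I erefl); rewrite /= in_itv.
(* The witness is made total, with a dummy for pairs not separated by [psi], so that choice yields
   one function of the pair. *)
have wit (pq : E * E) : exists xf : M * (M -> R), psi pq.1 != psi pq.2 ->
    [/\ continuous xf.2, forall w, 0 <= xf.2 w <= 1,
        xf.2 (sval pq.1 xf.1) = 0 & xf.2 (sval pq.2 xf.1) = 1].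
  have [psiE|] := eqVneq (psi pq.1) (psi pq.2); first by exists (x0, cst 0).
  move=> npsi.
  have [x nx] : exists x, sval pq.1 x <> sval pq.2 x.
    apply/existsNP => pqE; move/eqP: npsi; apply; congr psi.
    by apply: eq_sig_hprop; [move=> *; exact: Prop_irrelevance | exact: funext].
  by have [f fP] := urysohn _ _ nx; exists (x, f).
have [w wP] := choice wit.
pose P := [set pq : E * E | psi pq.1 != psi pq.2].
have psi_loc p : \forall p' \near p, psi p' = psi p.
  by apply: (psic p [set psi p]); exact: discrete_set1.
have cP : compact P.
  apply: (@subclosed_compact _ _ ([set: E] `*` [set: E])); last by [].
    rewrite -[P]setCK; apply: open_closedC; rewrite openE => -[p q] /= /negP.
    rewrite negbK => /eqP pq; exists ([set p' | psi p' = psi p], [set q' | psi q' = psi q]).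
      by split=> /=; exact: psi_loc.
    by move=> [p' q'] [/= p'p q'q]; rewrite /P /= p'p q'q pq eqxx.
  by apply: compact_setX; exact: Env_compact.
pose U (pq : E * E) := [set rs : E * E |
  2^-1 < `|(w pq).2 (sval rs.1 (w pq).1) - (w pq).2 (sval rs.2 (w pq).1)|].
have [||D DP covD] := @compact_finite_subcover _ _ P P U cP.
- move=> pq /wP [fc _ _ _].
  have evc (k : E * E -> E) : continuous k ->
      continuous (fun rs => (w pq).2 (sval (k rs) (w pq).1)).
    move=> kc rs; apply: (@continuous_comp _ _ _ (fun rs => sval (k rs) (w pq).1) (w pq).2); last exact: fc.
    apply: (@continuous_comp _ _ _ k (fun r : E => sval r (w pq).1)); first exact: kc.
    exact: Env_eval_continuous.
  have gc : continuous (fun rs : E * E =>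
      `|(w pq).2 (sval rs.1 (w pq).1) - (w pq).2 (sval rs.2 (w pq).1)|).
    move=> rs; apply: cvg_norm; apply: cvgB; apply: evc => ?.
      exact: cvg_fst.
    exact: cvg_snd.
  have oc : open [set r : R | 2^-1 < r] by exact: open_gt.
  by apply: open_comp oc => rs _; exact: gc.
- move=> pq Ppq; exists pq => //; rewrite /U /=.
  by have [_ _ -> ->] := wP _ Ppq; rewrite sub0r normrN normr1 invf_lt1 // ltr1n.
pose d (i : 'I_(size D)) := tnth (in_tuple D) i.
have Pd i : psi (d i).1 != psi (d i).2 by apply: DP; exact: mem_tnth.
(* [None] carries a harmless constant observation and keeps the index type inhabited even when [D]
   is empty. *)
exists (option 'I_(size D) : finType), None,
  (fun o => if o is Some i then (w (d i)).1 else x0),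
  (fun o => if o is Some i then (w (d i)).2 else cst 0).
split.
- case=> [i|]; last by move=> ?; exact: cst_continuous.
  by have [] := wP _ (Pd i).
- case=> [i|] y; last by rewrite lexx ler01.
  by have [] := wP _ (Pd i).
move=> p q pq; apply/eqP/negPn/negP => npq.
have [_ /seq_tnthP[i ->] Ui] := covD (p, q) npq.
by have := pq (Some i); rewrite /= ltNge => /negP; apply; exact: ltW.
Qed.

End Separation.

(* However a colouring of [G] at resolution [n] is chosen, some translate of it
   fails to tell apart, simultaneously from all viewpoints [a i], two elements of
   the finite set [Phi] that [T] tells apart. *)
Definition outcolours (G : Type) (mul : G -> G -> G) (T : G -> bool)
    (Q : nat -> Type) (q : forall n, G -> Q n) :=
  forall (n : nat) (I : finType), I -> exists Phi : set G, finite_set Phi /\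
  forall (F : set G) (C : finType) (chi : Q n -> C), finite_set F ->
  exists g, forall a : I -> G, (forall i, F (a i)) ->
  exists h h', [/\ Phi h, Phi h', T h != T h' & forall i,
    chi (q n (mul g (mul (a i) h))) = chi (q n (mul g (mul (a i) h')))].

Lemma truncn_dist (R : realType) (n : nat) (x y : R) :
  0 <= x -> 0 <= y -> Num.truncn (x * n.+1%:R) = Num.truncn (y * n.+1%:R) ->
  `|x - y| < n.+1%:R^-1.
Proof.
move=> x0 y0 xy; have n0 : 0 < n.+1%:R :> R by rewrite ltr0n.
have /truncn_itv/andP[xl xu] : 0 <= x * n.+1%:R by rewrite mulr_ge0 // ltW.
have /truncn_itv/andP[yl yu] : 0 <= y * n.+1%:R by rewrite mulr_ge0 // ltW.
rewrite -[_^-1]mul1r ltr_pdivlMr // -[X in _ * X](gtr0_norm n0) -normrM mulrBl.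
move: xl xu yl yu; rewrite xy; set m := Num.truncn _; rewrite -!(natr1 m).
by move=> ? ? ? ?; rewrite ltr_norml; apply/andP; split; lra.
Qed.

(** * From colourings of the group to non-isomorphism of ambits *)

Section Criterion.
Variables (R : realType) (G : topologicalType) (mul : G -> G -> G) (e : G).
Variables (T : G -> bool) (Q : nat -> Type) (q : forall n, G -> Q n).
Hypotheses (mulA : associative mul) (mul1g : left_id e mul) (mulg1 : right_id e mul).
Hypothesis T_loc : forall g x, \forall g' \near g,
  forall a, T (mul a (mul g' x)) = T (mul a (mul g x)).
Hypothesis q_base : forall W, nbhs e W -> exists n,
  forall g g', q n g = q n g' -> exists2 u, W u & g' = mul g u.
Hypothesis q_outcolours : outcolours mul T q.

Section Flow.
Variables (M : topologicalType) (act : M -> G -> M).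
Hypothesis hM : minimal_flow mul e act.

(** The orbit of a single point [x0] is coloured by rounded values of all [f i]. By minimality each
    [x i] is approximated from any point of that orbit by some translate [a i] out of a finite list,
    so [q_outcolours] produces [h] and [h'] that [T] distinguishes while all observations nearly
    agree. *)
Lemma no_finite_determination (I : finType) (i0 : I) (x : I -> M) (f : I -> M -> R) :
  (forall i, continuous (f i)) -> (forall i y, 0 <= f i y <= 1) ->
  ~ (forall g g', (forall i, `|f i (act (x i) g) - f i (act (x i) g')| < 2^-1) ->
       T g = T g').
Proof.
move=> fc f01 detT; have [hflow _ _] := hM; have [_ _ _ actM _] := hflow.
(* Five errors below [d] are added at the end: two approximations of [x i], two passages to a
   representative and one rounding; [5/16 < 1/2]. *)
pose d : R := 16%:R^-1.
have d0 : 0 < d by rewrite invr_gt0 ltr0n.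
have [n qn] : exists n, forall g g', q n g = q n g' ->
    forall i y, `|f i (act y g') - f i (act y g)| < d.
  have : \forall u \near e, forall i y, `|f i (act y u) - f i y| < d.
    by apply: filter_forall => i; exact: flow_equicontinuous hflow (fc i) d0.
  move=> /q_base[n qn]; exists n => g g' /qn[u Wu ->] i y.
  by rewrite -actM; exact: Wu.
have [Phi [finPhi hPhi]] := q_outcolours n i0.
have near_x i : \forall y \near x i,
    forall h, Phi h -> `|f i (act y h) - f i (act (x i) h)| < d.
  have /finite_seqP[s Ps] := finPhi.
  suff : \forall y \near x i,
      forall h, h \in s -> `|f i (act y h) - f i (act (x i) h)| < d.
    by apply: filterS => y sy h; rewrite Ps => /sy.
  apply: near_seq => h _.
  have k : continuous (fun y => f i (act y h)).
    by move=> y; apply: (@continuous_comp _ _ _ (act ^~ h)); [exact: flow_cont_at hflow _ _|exact: fc].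
  have := k (x i) => /cvgrPdist_lt/(_ d d0); apply: filterS => y.
  by rewrite distrC.
have /choice[s hs] i : exists s : seq G, forall y, exists2 a, a \in s &
    forall h, Phi h -> `|f i (act (act y a) h) - f i (act (x i) h)| < d.
  exact: minimal_syndetic hM (near_x i).
pose x0 := x i0.
(* The values lie in [[0, 1]], so the integer part of 16 times a value takes 17 values. *)
pose col g : {ffun I -> 'I_17} := [ffun i => inord (Num.truncn (f i (act x0 g) * 16%:R))].
have colP g g' i : col g = col g' -> `|f i (act x0 g) - f i (act x0 g')| < d.
  move=> /ffunP/(_ i); rewrite !ffunE => /(congr1 (@nat_of_ord _)).
  have b g1 : (Num.truncn (f i (act x0 g1) * 16%:R) < 17)%N.
    rewrite ltnS truncn_le_nat; have /andP[_ f1] := f01 i (act x0 g1).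
    by rewrite (le_lt_trans (_ : _ <= 16%:R)) ?ltr_nat // ler_piMl.
  rewrite !inordK ?b // => tE; apply: truncn_dist tE.
    by have /andP[] := f01 i (act x0 g).
  by have /andP[] := f01 i (act x0 g').
pose rep (r : Q n) := xget e [set g | q n g = r].
have repP g : q n (rep (q n g)) = q n g.
  by apply: (@xgetPex _ e [set g' | q n g' = q n g]); exists g.
pose F : set G := [set a | exists i, a \in s i].
have finF : finite_set F.
  apply/finite_seqP; exists (flatten [seq s i | i <- enum I]).
  apply/seteqP; split=> [a [i ai]|a /flatten_mapP[i _ ai]]; last by exists i.
  by apply/flatten_mapP; exists i => //; rewrite mem_enum.
have [g gP] := hPhi F _ (fun r => col (rep r)) finF.
have /choice[a aP] i : exists a, F a /\
    forall h, Phi h -> `|f i (act (act (act x0 g) a) h) - f i (act (x i) h)| < d.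
  by have [a as_ aP] := hs i (act x0 g); exists a; split=> //; exists i.
have [h [h' [Ph Ph' Tne colE]]] := gP a (fun i => (aP i).1).
move/eqP: Tne; apply; apply: detT => i.
have m1 := (aP i).2 h Ph; have m2 := (aP i).2 h' Ph'.
rewrite !actM in m1 m2.
have r1 := qn _ _ (repP (mul g (mul (a i) h))) i x0.
have r2 := qn _ _ (repP (mul g (mul (a i) h'))) i x0.
have c := colP _ _ i (colE i).
move: m1 m2 r1 r2 c; rewrite /d !ltr_norml => /andP[? ?] /andP[? ?] /andP[? ?].
by move=> /andP[? ?] /andP[? ?]; apply/andP; split; lra.
Qed.

End Flow.

(** The inverse isomorphism followed by the morphism from [S] to the orbit closure of [T] and
    evaluation at [e] is a continuous boolean function on [Env actM] that extends [T]; finite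
    determination of it is then contradictory. *)
Theorem S_not_iso_EM_criterion : S_not_iso_EM mul e.
Proof.
move=> S actS s0 [ambS univS] M actM hM [f [f' [[fc fs0 fM] f'c ff' f'f]]].
have [[hflow [x0 _] dense] _] := hM.
have [phi [phic phis0 phiM]] := univS _ _ _ (orbit_closure_ambit mulA mul1g T_loc).
pose hflow' := umf_is_flow hM.
pose psi (p : Env actM) : bool := sval (phi (f' p)) e.
have psi_c : continuous psi.
  move=> p; apply: (@continuous_comp _ _ _ (fun p => phi (f' p))
    (fun t : orbit_closure mul T => sval t e)).
    by apply: (@continuous_comp _ _ _ f' phi); [exact: f'c | exact: phic].
  apply: (@continuous_comp _ _ _ (sval : orbit_closure mul T -> _)
    (fun t : {ptws G -> bool} => t e)); first exact: initial_continuous.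
  exact: proj_continuous.
pose ev g := Env_act hflow' (Env_base hflow') g.
have psi_ev g : psi (ev g) = T g.
  rewrite /psi /ev -fs0 -fM ff' phiM phis0 /=.
  by rewrite /shift mulg1.
have [I [i0 [x [h [hc h01 hdet]]]]] := Env_finite_determination R hflow' x0 psi_c.
apply: (no_finite_determination hM.1 i0 hc h01 (x := x)).
by move=> g g' gg'; rewrite -!psi_ev; apply: hdet => i; exact: gg'.
Qed.

End Criterion.

(** [Z] is a set of places, [X] the labels and [real] turns a labelling into a group element.
    [star a] lists the places as seen from the viewpoint [a], and [dec] recovers the trace of a
    translate from the labels read along the word [W]. With [W] from [ramsey_words], the colour seen
    from [a] depends only on an initial segment of that list. *)
Lemma outcolours_of_labels (G : choiceType) (mul : G -> G -> G) (T : G -> bool)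
    (Q : nat -> Type) (q : forall n, G -> Q n) :
  (forall (n : nat) (I : finType), I -> exists (X Z : finType) (x0 : X)
      (real : (Z -> X) -> G) (H : set (Z -> X)) (J : nat),
    [/\ (J <= #|Z|)%N,
      forall S : I -> {set Z}, (forall i, #|S i| = J) -> exists phi phi',
        [/\ H phi, H phi', T (real phi) != T (real phi'),
            forall i z, z \in S i -> phi z = phi' z &
            forall i x, exists2 z, z \in S i & phi z = x] &
      forall F : set G, finite_set F -> exists m (star : G -> 'I_m -> Z),
        (forall a z, F a -> exists p, star a p = z) /\
        forall N, exists dec : seq X -> Q n, forall W : seq 'I_m,
          size W = N -> (forall i, i \in W) ->
          exists g, forall a phi, F a -> H phi ->
            q n (mul g (mul a (real phi))) = dec [seq phi (star a i) | i <- W]]) ->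
  outcolours mul T q.
Proof.
move=> lab n I i0; have [X [Z [x0 [real [H [J [JZ sep star]]]]]]] := lab n I i0.
exists (real @` H); split.
  apply: (@sub_finite_set _ _ ((fun phi : {ffun Z -> X} => real phi) @` setT)).
    move=> _ [phi _ <-]; exists (finfun phi) => //.
    by congr real; apply: funext => z; rewrite ffunE.
  exact: finite_image.
move=> F C chi finF; have [m [st [st_onto Th]]] := star F finF.
have [N hN] := ramsey_words C x0 m; have [dec ThP] := Th N.
have [W [sW onW mW]] := hN (chi \o dec).
have [g gP] := ThP W sW onW; exists g => a Fa.
(* From each viewpoint the segment is cut when exactly [J] places have been exposed; these are the
   sets [S i] off which the labelling may change. *)
have /choice[j jP] : forall i, exists j, #|prefix_image (st (a i)) j| = J.
  by move=> i; apply: prefix_image_card JZ => z; exact: st_onto.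
have [phi [phi' [Hphi Hphi' Tne phiE phi_onto]]] := sep _ jP.
exists (real phi), (real phi'); split=> //; try by [exists phi | exists phi'].
move=> i; rewrite !gP //; apply: (mW _ _ (j i)) => [k kj|x].
  by apply: (phiE i); apply/prefix_imageP; exists k.
have [z /prefix_imageP[k kj <-] <-] := phi_onto i x.
by exists k.
Qed.

(** * Vector spaces over a finite field *)

Section FreeSelection.
Variables (F : finFieldType) (d : nat).
Local Notation V := 'rV[F]_d.

Lemma card_span_leq (b : seq V) : (#|[pred v | v \in <<b>>%VS]| <= #|F| ^ size b)%N.
Proof.
pose comb (c : {ffun 'I_(size b) -> F}) : V := \sum_i c i *: b`_i.
rewrite -[X in (_ <= _ ^ X)%N]card_ord -card_ffun.
apply: leq_trans (leq_image_card comb _); apply: subset_leq_card.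
apply/fintype.subsetP => v; rewrite inE => bv; apply/fintype.imageP.
exists [ffun i => coord (in_tuple b) i v]; first by [].
by rewrite /comb {1}(@coord_span _ _ _ (in_tuple b) v bv);
  apply: eq_bigr => i _; rewrite ffunE.
Qed.

(** Greedy choice: the span of the vectors chosen so far is too small to contain the next set. *)
Lemma free_selection (s : seq {set V}) :
  (forall B, B \in s -> #|F| ^ size s < #|B|)%N ->
  exists b : seq V, [/\ size b = size s, free b &
    forall i, (i < size s)%N -> b`_i \in nth finset.set0 s i].
Proof.
elim: s => [|B s IH] sB; first by exists [::]; rewrite nil_free.
have F0 : (0 < #|F|)%N by apply/card_gt0P; exists 0.
have [|b [sb fb bs]] := IH.
  move=> C Cs; apply: leq_ltn_trans (sB C _); last by rewrite inE Cs orbT.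
  by rewrite leq_pexp2l.
have [v vB vb] : exists2 v, v \in B & v \notin <<b>>%VS.
  apply/exists_inP; rewrite -[X in is_true X]negbK negb_exists_in.
  apply/negP => /forall_inP Bb.
  have := sB B (mem_head _ _); rewrite ltnNge => /negP; apply.
  apply: leq_trans (_ : #|F| ^ size b <= _)%N; last by rewrite leq_pexp2l //= sb leqnSn.
  apply: leq_trans (card_span_leq b); apply: subset_leq_card.
  by apply/fintype.subsetP => v /Bb; rewrite negbK.
exists (v :: b); split; rewrite /= ?sb ?free_cons ?vb //.
by case=> [|i] //; rewrite ltnS => /bs.
Qed.

End FreeSelection.

(** * A hyperbolic quadratic form *)

Section PairingForm.
Variable F : fieldType.

(** Coefficients of even index are paired with their odd successors. The bound [size p] overshoots,
    but the additional terms vanish. *)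
Definition pairing_form (p : {poly F}) : F :=
  \sum_(i < size p) p`_i.*2 * p`_i.*2.+1.

Definition dotp n (u v : 'rV[F]_n) : F := (u *m v^T) 0 0.

Lemma dotpDl n (u v w : 'rV[F]_n) : dotp (u + v) w = dotp u w + dotp v w.
Proof. by rewrite /dotp mulmxDl mxE. Qed.

Lemma dotpDr n (u v w : 'rV[F]_n) : dotp u (v + w) = dotp u v + dotp u w.
Proof. by rewrite /dotp linearD mulmxDr mxE. Qed.

Lemma dotpZl n a (u v : 'rV[F]_n) : dotp (a *: u) v = a * dotp u v.
Proof. by rewrite /dotp -scalemxAl mxE. Qed.

Lemma dotpZr n a (u v : 'rV[F]_n) : dotp u (a *: v) = a * dotp u v.
Proof. by rewrite /dotp linearZ -scalemxAr mxE. Qed.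

Variable N : nat.

(** Right multiplication by [even_mx^T] extracts the even coordinates, and by [even_mx] reinserts
    them; likewise for [odd_mx]. *)
Definition even_mx : 'M[F]_(N, N.*2) := \matrix_(i, j) (j == i.*2 :> nat)%:R.
Definition odd_mx : 'M[F]_(N, N.*2) := \matrix_(i, j) (j == i.*2.+1 :> nat)%:R.

Lemma mul_even_mx (v : 'rV[F]_N.*2) i : (v *m even_mx^T) 0 i = (rVpoly v)`_i.*2.
Proof.
have iN : (i.*2 < N.*2)%N by rewrite ltn_double.
rewrite mxE (bigD1 (Ordinal iN)) //= !mxE eqxx mulr1 big1 ?addr0.
  by rewrite (coef_rVpoly_ord v (Ordinal iN)).
by move=> j; rewrite -val_eqE /= !mxE => /negPf->; rewrite mulr0.
Qed.

Lemma mul_odd_mx (v : 'rV[F]_N.*2) i : (v *m odd_mx^T) 0 i = (rVpoly v)`_i.*2.+1.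
Proof.
have iN : (i.*2.+1 < N.*2)%N by rewrite ltn_Sdouble.
rewrite mxE (bigD1 (Ordinal iN)) //= !mxE eqxx mulr1 big1 ?addr0.
  by rewrite (coef_rVpoly_ord v (Ordinal iN)).
by move=> j; rewrite -val_eqE /= !mxE => /negPf->; rewrite mulr0.
Qed.

Lemma even_mxK : even_mx *m even_mx^T = 1%:M.
Proof.
apply/row_matrixP => i; apply/rowP => j; rewrite row_mul mul_even_mx.
have iN : (j.*2 < N.*2)%N by rewrite ltn_double.
rewrite (coef_rVpoly_ord _ (Ordinal iN)) !mxE /=.
by rewrite -mul2n -[X in _ == X]mul2n eqn_pmul2l // eq_sym.
Qed.

Lemma odd_mxK : odd_mx *m odd_mx^T = 1%:M.
Proof.
apply/row_matrixP => i; apply/rowP => j; rewrite row_mul mul_odd_mx.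
have iN : (j.*2.+1 < N.*2)%N by rewrite ltn_Sdouble.
rewrite (coef_rVpoly_ord _ (Ordinal iN)) !mxE /= eqSS.
by rewrite -mul2n -[X in _ == X]mul2n eqn_pmul2l // eq_sym.
Qed.

Lemma even_odd_mx : even_mx *m odd_mx^T = 0.
Proof.
apply/row_matrixP => i; apply/rowP => j; rewrite row_mul mul_odd_mx.
have iN : (j.*2.+1 < N.*2)%N by rewrite ltn_Sdouble.
rewrite (coef_rVpoly_ord _ (Ordinal iN)) !mxE /=.
by case: eqP => // /(congr1 odd); rewrite /= !odd_double.
Qed.

Lemma odd_even_mx : odd_mx *m even_mx^T = 0.
Proof. by rewrite -[LHS]trmxK trmx_mul trmxK even_odd_mx trmx0. Qed.

Lemma pairing_form_rVpoly (v : 'rV[F]_N.*2) :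
  pairing_form (rVpoly v) = dotp (v *m even_mx^T) (v *m odd_mx^T).
Proof.
have -> : dotp (v *m even_mx^T) (v *m odd_mx^T) =
    \sum_(i < N) (rVpoly v)`_i.*2 * (rVpoly v)`_i.*2.+1.
  rewrite /dotp mxE; apply: eq_bigr => i _.
  by rewrite mul_even_mx [X in _ * X]mxE mul_odd_mx.
have sv : (size (rVpoly v) <= N.*2)%N by exact: size_poly.
set p := rVpoly v in sv *.
have ext K m : (forall i, (K <= i)%N -> p`_i.*2 = 0) ->
    \sum_(i < K) p`_i.*2 * p`_i.*2.+1 = \sum_(i < K + m) p`_i.*2 * p`_i.*2.+1.
  move=> pK; rewrite big_split_ord /= [X in _ + X]big1 ?addr0 // => i _.
  by rewrite pK ?mul0r // leq_addr.
rewrite /pairing_form (ext _ N) => [|i pi]; last first.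
  by rewrite nth_default // (leq_trans pi) // -addnn leq_addr.
rewrite (ext N (size p)) => [|i Ni]; last first.
  by rewrite nth_default // (leq_trans sv) // leq_double.
by rewrite addnC.
Qed.

Variables (k : nat) (D : 'M[F]_(k, N.*2)) (v : 'rV[F]_N.*2).

(* On the even and on the odd coordinates the annihilator of [D] has codimension
   at most [k < N / 2], so the pairing does not vanish between the two parts. *)
Lemma pairing_form_onto (r : F) : (k.*2 < N)%N ->
  exists2 c : 'rV[F]_N.*2, c *m D^T = 0 & pairing_form (rVpoly (v + c)) = r.
Proof.
move=> kN; pose P := even_mx *m D^T; pose R := odd_mx *m D^T.
(* Both kernels have rank at least [N - k]. Were they orthogonal, the ranks would add up to at most
   [N], against [k.*2 < N]. *)
have [i [j ij]] : exists i j, (kermx P *m (kermx R)^T) i j != 0.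
  apply/matrix0Pn/negP => /eqP /mulmx0_rank_max.
  rewrite mxrank_tr !mxrank_ker.
  have := rank_leq_col P; have := rank_leq_col R; move: kN; rewrite -addnn.
  by move: (\rank P) (\rank R) => a b; clear; lia.
pose dv := row i (kermx P); pose ev := row j (kermx R).
have dP : dv *m P = 0 by rewrite /dv -row_mul mulmx_ker row0.
have eR : ev *m R = 0 by rewrite /ev -row_mul mulmx_ker row0.
have de : dotp dv ev != 0.
  rewrite /dotp; move: ij; rewrite !mxE; congr (_ != 0).
  by apply: eq_bigr => l _; rewrite !mxE.
pose x := v *m even_mx^T; pose y := v *m odd_mx^T.
(* [s] makes the modified even part pair to 1 with [ev]; the form is then affine in [t] with slope
   1, and [t] adjusts its value to [r]. *)
pose s := (1 - dotp x ev) / dotp dv ev.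
pose t := r - dotp x y - s * dotp dv y.
exists (s *: (dv *m even_mx) + t *: (ev *m odd_mx)).
  by rewrite mulmxDl -!scalemxAl -!mulmxA dP eR !scaler0 addr0.
rewrite pairing_form_rVpoly !mulmxDl -!scalemxAl -!(mulmxA _ even_mx) -!(mulmxA _ odd_mx).
rewrite even_mxK odd_mxK even_odd_mx odd_even_mx !mulmx0 !mulmx1 !scaler0 addr0 add0r.
rewrite -/x -/y !dotpDl !dotpDr !dotpZl !dotpZr.
have st : dotp x ev + s * dotp dv ev = 1 by rewrite /s divfK // addrC subrK.
by rewrite mulrCA addrACA -mulrDr st mulr1 /t -(addrA r) -opprD addrC subrK.
Qed.

End PairingForm.

(** * The automorphism group of [{poly F}] *)

Section LinearGroup.
Variable F : finFieldType.
Local Notation G := (Aut F).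

Lemma aut_eq (g h : G) : (forall p, sval g p = sval h p) -> g = h.
Proof.
move=> gh; apply: eq_sig_hprop; first by move=> *; exact: Prop_irrelevance.
exact: funext.
Qed.

Definition aut_fun (g : G) : {poly F} -> {poly F} := sval g.

Lemma aut_linear (g : G) : linear (aut_fun g).
Proof. by have [] := set_mem (svalP g). Qed.

HB.instance Definition _ g :=
  GRing.isLinear.Build F {poly F} {poly F} _ (aut_fun g) (aut_linear g).

Lemma aut_inj (g : G) : injective (aut_fun g).
Proof. by have [_ /bij_inj] := set_mem (svalP g). Qed.

Lemma aut_exists (f f' : {poly F} -> {poly F}) : linear f -> cancel f f' ->
  cancel f' f -> exists g : G, aut_fun g = f.
Proof.
move=> fl ff' f'f.
have fP : aut_set (f : {ptws {poly F} -> discrete_topology {poly F}}).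
  by split=> //; exists f'.
by exists (exist (fun x => x \in @aut_set F) _ (mem_set fP)).
Qed.

Lemma aut_inv_exists (g : G) : exists g' : G, aut_mul g g' = aut_id F.
Proof.
have [f gf fg] : bijective (aut_fun g) by have [] := set_mem (svalP g).
have fl : linear f.
  by move=> a u v; apply: (@aut_inj g); rewrite linearP /= !fg.
have [g' g'E] := aut_exists fl fg gf.
by exists g'; apply: aut_eq => p /=; rewrite -/(aut_fun g' p) g'E; exact: fg.
Qed.

Lemma aut_mulA : associative (@aut_mul F).
Proof. by move=> x y z; apply: aut_eq. Qed.

Lemma aut_mul1g : left_id (aut_id F) (@aut_mul F).
Proof. by move=> x; apply: aut_eq. Qed.

Lemma aut_mulg1 : right_id (aut_id F) (@aut_mul F).
Proof. by move=> x; apply: aut_eq. Qed.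

Definition aut_test (g : G) : bool := pairing_form (aut_fun g 1) == 0.

(** The test on [a g x] sees [g] only through the image of the single vector [p], and fixing that
    image is an open condition. *)
Lemma aut_test_loc (g x : G) : \forall g' \near g,
  forall a, aut_test (aut_mul a (aut_mul g' x)) = aut_test (aut_mul a (aut_mul g x)).
Proof.
pose p := aut_fun x 1.
apply/nbhs_set_type; exists [set f | f p = aut_fun g p].
  apply: (@proj_continuous _ (fun=> discrete_topology {poly F}) p (sval g)
    [set aut_fun g p]).
  exact: (@discrete_set1 (discrete_topology {poly F})).
move=> g' gg' a; rewrite /aut_test /aut_fun /=.
by congr (pairing_form (sval a _) == 0); exact: gg'.
Qed.

(** Equal traces mean the same left coset of the pointwise stabiliser of the polynomials of degree
    at most [n]. *)
Definition aut_trace (n : nat) (g : G) (i : 'I_n.+1) : {poly F} := aut_fun g 'X^i.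

Lemma aut_trace_base (W : set G) : nbhs (aut_id F) W -> exists n,
  forall g g', aut_trace (n := n) g = aut_trace g' ->
  exists2 u, W u & g' = aut_mul g u.
Proof.
move=> /nbhs_set_type[V V1 VW].
have [n nV] : exists n, forall u : G,
    (forall i, (i <= n)%N -> aut_fun u 'X^i = 'X^i) -> V (sval u).
  pose FF : set_system {ptws {poly F} -> discrete_topology {poly F}} :=
    [set A | exists n, forall u : G,
      (forall i, (i <= n)%N -> aut_fun u 'X^i = 'X^i) -> A (sval u)].
  have Filt : Filter FF.
    split; first by exists 0%N.
      move=> A B [n nA] [m mB]; exists (maxn n m) => u un; split.
        by apply: nA => i ni; apply: un; rewrite leq_max ni.
      by apply: mB => i mi; apply: un; rewrite leq_max mi orbT.
    by move=> A B AB [n nA]; exists n => u /nA /AB.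
  suff : FF --> (sval (aut_id F)) by move=> /(_ V V1).
  apply: ptws_cvg => p A /= pA; exists (size p) => u uX.
  suff -> : sval u p = p by exact: (nbhs_singleton pA).
  rewrite -/(aut_fun u p) -[in LHS](coefK p) poly_def linear_sum.
  rewrite -[RHS](coefK p) poly_def; apply: eq_bigr => i _.
  by rewrite linearZ /= uX // ltnW.
exists n => g g' gg'; have [h gh] := aut_inv_exists g.
have [h' hh'] := aut_inv_exists h.
have hg : aut_mul h g = aut_id F.
  by rewrite -[aut_mul h g]aut_mulg1 -hh' aut_mulA -(aut_mulA h) gh aut_mulg1.
exists (aut_mul h g'); last by rewrite aut_mulA gh aut_mul1g.
apply: VW; apply: nV => i iN.
rewrite -[RHS]/(aut_fun (aut_id F) _) -hg.
by congr (sval h _); have := congr1 (@^~ (inord i)) gg'; rewrite /aut_trace inordK.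
Qed.

Lemma aut_rVpoly (g : G) (m L : nat) (B : 'M[F]_(m, L)) (u : 'rV_m) :
  (forall i : 'I_m, aut_fun g 'X^i = rVpoly (row i B)) ->
  aut_fun g (rVpoly u) = rVpoly (u *m B).
Proof.
move=> gB; rewrite {1}[u]row_sum_delta !linear_sum /=.
rewrite mulmx_sum_row linear_sum; apply: eq_bigr => i _.
by rewrite !linearZ /= rVpoly_delta gB.
Qed.

(** The rows of [B] are completed to an invertible matrix acting on the first [L] coefficients;
    higher coefficients are left fixed. *)
Lemma aut_extend (m L : nat) (B : 'M[F]_(m, L)) : row_free B ->
  exists g : G, forall i : 'I_m, aut_fun g 'X^i = rVpoly (row i B).
Proof.
move=> fB; have mL : (m <= L)%N by rewrite -(eqP fB) rank_leq_col.
have BE : (pid_mx m : 'M[F]_(m, L)) *m ((pid_mx m : 'M[F]_(L, m)) *m B) = B.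
  by rewrite mulmxA pid_mx_id // pid_mx_1 mul1mx.
have [|C uC CB] := @complete_unitmx F m L (pid_mx m) ((pid_mx m : 'M[F]_(L, m)) *m B).
  by rewrite BE rank_pid_mx //; exact/eqP.
pose f (D : 'M[F]_L) (p : {poly F}) :=
  rVpoly (poly_rV p *m D) + drop_poly L p * 'X^L.
have fl D : linear (f D).
  move=> a u v; rewrite /f linearP mulmxDl -scalemxAl linearP.
  by rewrite drop_polyD drop_polyZ mulrDl scalerDr -scalerAl addrACA.
have fK D D' : D *m D' = 1%:M -> cancel (f D) (f D').
  move=> DD' p; rewrite /f drop_polyDMXn ?size_poly // linearD /= rVpolyK.
  have -> : poly_rV (drop_poly L p * 'X^L) = 0 :> 'rV_L.
    by apply/rowP => i; rewrite !mxE coefMXn ltn_ord.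
  rewrite addr0 -mulmxA DD' mulmx1 -[RHS](poly_take_drop L); congr (_ + _).
  rewrite -(poly_rV_K (size_take_poly L p)); congr rVpoly.
  by apply/rowP => i; rewrite !mxE coef_take_poly ltn_ord.
have [g gE] := aut_exists (fl C) (fK _ _ (mulmxV uC)) (fK _ _ (mulVmx uC)).
exists g => i; rewrite gE /f; have iL := leq_trans (ltn_ord i) mL.
rewrite drop_poly_eq0 ?size_polyXn // mul0r addr0; congr rVpoly.
rewrite -BE CB row_mul; congr (_ *m _).
apply/rowP => j; rewrite !mxE coefXn ltn_ord andbT.
by rewrite eq_sym.
Qed.

(** * Linear labellings and their realization by automorphisms *)

Section Labels.
Variables (n N : nat).
Local Notation X := 'rV[F]_n.+1.
Local Notation Z := 'rV[F]_N.

(** The columns of [A] are to be the images of the first [n.+1] basis vectors, whence their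
    independence. A place [z] is a linear functional, and its label lists its values on these
    columns. *)
Definition linear_labels : set (Z -> X) :=
  [set phi | exists2 A : 'M[F]_(N, n.+1), row_free A^T & phi = (fun z : Z => z *m A)].

Lemma linear_labels_realized : exists real : (Z -> X) -> G,
  forall A : 'M[F]_(N, n.+1), row_free A^T -> forall i : 'I_n.+1,
  aut_fun (real (fun z : Z => z *m A)) 'X^i = rVpoly (row i A^T).
Proof.
have [phi|real realP] := @choice (Z -> X) G (fun phi h =>
  forall A : 'M[F]_(N, n.+1), row_free A^T -> phi = (fun z : Z => z *m A) ->
  forall i : 'I_n.+1, aut_fun h 'X^i = rVpoly (row i A^T)).
  have [[A fA ->]|no] := pselect (linear_labels phi).
    have [h hA] := aut_extend fA; exists h => A' _ AA'.
    suff <- : A = A' by [].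
    apply/row_matrixP => i; rewrite !rowE.
    by have := congr1 (@^~ (delta_mx 0 i)) AA'.
  by exists (aut_id F) => A fA phiA; case: no; exists A.
by exists real => A fA i; exact: (realP (fun z : Z => z *m A) A fA erefl).
Qed.

Lemma onto_row_free (A : 'M[F]_(N, n.+1)) :
  (forall x : X, exists z : Z, z *m A = x) -> row_free A^T.
Proof.
move=> onto; apply: inj_row_free => u uA.
suff uz x : u *m x^T = 0 :> 'M[F]_1.
  by apply/rowP => i; have := uz (delta_mx 0 i); rewrite trmx_delta -colE =>
    /matrixP/(_ 0 0); rewrite !mxE.
have [z <-] := onto x; rewrite trmx_mul mulmxA.
by rewrite uA mul0mx.
Qed.

(** Its transpose is the pullback of functionals along [a], with images under [a] cut off at [m]
    coefficients. *)
Definition star_mx (m : nat) (a : G) : 'M[F]_(N, m) :=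
  \matrix_(j, i) (aut_fun a 'X^j)`_i.

Lemma star_mx_row (m : nat) (a : G) (j : 'I_N) :
  (size (aut_fun a 'X^j) <= m)%N -> aut_fun a 'X^j = rVpoly (row j (star_mx m a)).
Proof.
move=> sm; rewrite -(poly_rV_K sm); congr rVpoly.
by apply/rowP => i; rewrite !mxE.
Qed.

(** Injectivity of [a] dualizes to surjectivity of the pullback. *)
Lemma star_mx_onto (m : nat) (a : G) :
  (forall j : 'I_N, (size (aut_fun a 'X^j) <= m)%N) ->
  forall z : Z, exists u : 'rV[F]_m, u *m (star_mx m a)^T = z.
Proof.
move=> sm z; have : row_free (star_mx m a).
  apply: inj_row_free => v va; apply: (can_inj rVpolyK); apply: (@aut_inj a).
  by rewrite (aut_rVpoly (B := star_mx m a)) ?va ?linear0 // => j; exact: star_mx_row.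
rewrite /row_free -mxrank_tr => /row_fullP[B BA].
by exists (z *m B); rewrite -mulmxA BA mulmx1.
Qed.

End Labels.

Lemma aut_sizes_bounded (N : nat) (A : set G) : finite_set A ->
  exists m, forall a, A a -> forall j : 'I_N, (size (aut_fun a 'X^j) <= m)%N.
Proof.
move=> /finite_seqP[s ->].
exists (\max_(a <- s) \max_(j < N) size (aut_fun a 'X^j))%N => a /= sa j.
apply: leq_trans (leq_bigmax_seq _ sa _) => //.
exact: (leq_bigmax j (F := fun j : 'I_N => size (aut_fun a 'X^j))).
Qed.

(** Independent vectors, one in [S i] for each pair [(i, x)], allow a matrix [A0] whose labelling
    takes all values on every [S i]. Only its first column is then changed, by a vector killed by
    all functionals in all [S i]; [pairing_form_onto] leaves enough freedom to give the form the
    values 0 and 1. *)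
Lemma linear_labels_separate (n : nat) (I : finType) (J N : nat)
    (S : I -> {set 'rV[F]_N.*2}) :
  (#|F| ^ (#|I| * #|{: 'rV[F]_n.+1}|) < J)%N -> ((#|I| * J).*2 < N)%N ->
  (forall i, #|S i| = J) ->
  exists A A' : 'M[F]_(N.*2, n.+1),
    [/\ pairing_form (rVpoly (row 0 A^T)) = 0,
        pairing_form (rVpoly (row 0 A'^T)) = 1,
        forall i z, z \in S i -> z *m A = z *m A' &
        forall i x, exists2 z, z \in S i & z *m A = x].
Proof.
move=> FJ JN SJ; pose K := enum {: I * 'rV[F]_n.+1}.
have sK : size K = (#|I| * #|{: 'rV[F]_n.+1}|)%N by rewrite -cardE card_prod.
have [B|b [sb fb bS]] := @free_selection F N.*2 [seq S p.1 | p <- K].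
  by case/mapP => p _ ->; rewrite size_map sK SJ.
rewrite size_map in sb bS.
have [f fE] := linear_of_free b [seq p.2 | p <- K].
have {}fE := fE fb (etrans (size_map _ _) (esym sb)).
pose A0 := lin1_mx f.
have A0P i x : exists2 z, z \in S i & z *m A0 = x.
  have ixK : (i, x) \in K by rewrite mem_enum.
  have ltK : (index (i, x) K < size K)%N by rewrite index_mem.
  exists b`_(index (i, x) K).
    by have := bS _ ltK; rewrite (nth_map (i, x)) // nth_index.
  rewrite mul_rV_lin1 -(nth_map _ 0) ?sb // fE (nth_map (i, x)) //.
  by rewrite nth_index.
pose ip (p : 'I_#|{: I * 'I_J}|) : I * 'I_J := enum_val p.
(* [Dm] stacks all elements of all [S i], so [c *m Dm^T = 0] makes adding [c] to the first column
   invisible on them. *)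
pose Dm : 'M[F]_(#|{: I * 'I_J}|, N.*2) :=
  \matrix_p nth 0 (enum (S (ip p).1)) (ip p).2.
have DmP i z : z \in S i -> exists p, z = row p Dm.
  move=> zS; have zJ : (index z (enum (S i)) < J)%N.
    by rewrite -(SJ i) cardE index_mem mem_enum.
  exists (enum_rank (i, Ordinal zJ)); rewrite rowK /ip enum_rankK /= nth_index //.
  by rewrite mem_enum.
have kN : (#|{: I * 'I_J}|.*2 < N)%N by rewrite card_prod card_ord.
pose A (c : 'rV[F]_N.*2) := A0 + c^T *m delta_mx (0 : 'I_1) (0 : 'I_n.+1).
have A_S c : c *m Dm^T = 0 -> forall i z, z \in S i -> z *m A c = z *m A0.
  move=> cD i z /DmP[p ->]; rewrite /A mulmxDr mulmxA -(row_mul p Dm c^T).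
  by rewrite -[Dm *m c^T]trmxK trmx_mul trmxK cD trmx0 row0 mul0mx addr0.
have A_row c : row 0 (A c)^T = row 0 A0^T + c.
  by apply/rowP => j; rewrite !mxE big_ord1 !mxE !eqxx mulr1.
have [c cD c0] := pairing_form_onto Dm (row 0 A0^T) 0 kN.
have [c' cD' c1] := pairing_form_onto Dm (row 0 A0^T) 1 kN.
exists (A c), (A c'); split; rewrite ?A_row //.
  by move=> i z zS; rewrite (A_S _ cD i) // (A_S _ cD' i).
by move=> i x; have [z zS <-] := A0P i x; exists z => //; exact: A_S zS.
Qed.

Lemma aut_outcolours : outcolours (@aut_mul F) aut_test (fun n => @aut_trace n).
Proof.
apply: outcolours_of_labels => n I i0.
pose J := (#|F| ^ (#|I| * #|{: 'rV[F]_n.+1}|)).+1.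
pose N := (#|I| * J).*2.+1.
have [real realP] := linear_labels_realized n N.*2.
exists 'rV[F]_n.+1, 'rV[F]_N.*2, 0, real, (@linear_labels n N.*2), J; split.
- have I0 : (0 < #|I|)%N by apply/card_gt0P; exists i0.
  rewrite card_mx mul1n; apply: leq_trans (ltnW (ltn_expl _ (card_finNzRing_gt1 F))).
  by rewrite /N; nia.
- move=> S SJ; have [A [A' [A0 A1 AA' onto]]] :=
    linear_labels_separate (ltnSn _) (ltnSn _) SJ.
  have fA : row_free A^T.
    by apply: onto_row_free => x; have [z _ zx] := onto i0 x; exists z.
  have fA' : row_free A'^T.
    by apply: onto_row_free => x; have [z zS zx] := onto i0 x; exists z; rewrite -(AA' i0).
  exists (fun z : 'rV[F]_N.*2 => z *m A), (fun z : 'rV[F]_N.*2 => z *m A'); split=> //.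
  + by exists A.
  + by exists A'.
  have r1 B : row_free B^T -> aut_test (real (fun z : 'rV[F]_N.*2 => z *m B)) =
      (pairing_form (rVpoly (row 0 B^T)) == 0).
    by move=> fB; rewrite /aut_test -(realP B fB) expr0.
  by rewrite !r1 // A0 A1 eqxx oner_eq0.
move=> E finE; have [m sm] := aut_sizes_bounded N.*2 finE.
(* The letters enumerate all functionals on the first [m] coefficients; seen from [a], each is
   pulled back along [a]. *)
exists #|{: 'rV[F]_m}|, (fun a p => enum_val p *m (star_mx N.*2 m a)^T); split.
  move=> a z Ea; have [u uz] := star_mx_onto (sm a Ea) z.
  by exists (enum_rank u); rewrite enum_rankK.
move=> L; exists (fun (s : seq 'rV[F]_n.+1) (c : 'I_n.+1) =>
    \poly_(l < L) (nth 0 s l : 'rV[F]_n.+1) 0 c) => W sW onW.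
(* The translate [g] is built so that coefficient [l] of the image under [g] is the value of the
   functional at letter [l] of [W]. All letters occur in [W], in particular the coordinate
   functionals, so [B^T] is row free. *)
pose B : 'M[F]_(L, m) := \matrix_l nth 0 (map enum_val W) l.
have fB : row_free B^T.
  apply: inj_row_free => u uB; apply/rowP => i.
  have /(nthP (enum_rank 0))[l lW Wl] := onW (enum_rank (delta_mx 0 i)).
  have lL : (l < L)%N by rewrite -sW.
  have := congr1 (fun v : 'rV[F]_L => v 0 (Ordinal lL)) uB.
  rewrite !mxE (bigD1 i) //= big1 ?addr0 => [|j ji].
    rewrite !mxE (nth_map (enum_rank 0)) // Wl enum_rankK mxE !eqxx mulr1.
    exact.
  rewrite !mxE (nth_map (enum_rank 0)) // Wl enum_rankK mxE (negPf ji) andbF.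
  by rewrite mulr0.
have [g gB] := aut_extend fB; exists g => a phi Ea [A fA ->].
apply: funext => c; rewrite /aut_trace.
have -> : aut_fun (aut_mul g (aut_mul a (real (fun z : 'rV[F]_N.*2 => z *m A)))) 'X^c =
    rVpoly (row c A^T *m star_mx N.*2 m a *m B^T).
  rewrite -(aut_rVpoly _ gB) -(aut_rVpoly (g := a)) => [|i].
    by rewrite -(realP A fA).
  by apply: star_mx_row; exact: sm.
apply/polyP => l; rewrite coef_poly /rVpoly coef_poly; case: ltnP => // lL.
rewrite insubT -!row_mul mxE (nth_map (enum_rank 0)) ?sW //.
have -> : enum_val (nth (enum_rank 0) W l) = row (Ordinal lL) B.
  by rewrite rowK (nth_map (enum_rank 0)) ?sW.
rewrite -!row_mul [RHS]mxE.
have -> : B *m (star_mx N.*2 m a)^T *m A = (A^T *m star_mx N.*2 m a *m B^T)^T.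
  by rewrite !trmx_mul !trmxK mulmxA.
by rewrite [RHS]mxE [RHS]mxE [LHS]mxE.
Qed.

End LinearGroup.

Lemma aut_S_not_iso_EM (R : realType) (F : finFieldType) :
  S_not_iso_EM (@aut_mul F) (@aut_id F).
Proof.
apply: (S_not_iso_EM_criterion R (@aut_mulA F) (@aut_mul1g F) (@aut_mulg1 F)
  (@aut_test_loc F) _ (@aut_outcolours F)).
exact: aut_trace_base.
Qed.

(** * Homeomorphisms of the Cantor space *)

Definition agree (n : nat) (x y : cantor_space) : Prop :=
  forall i, (i < n)%N -> x i = y i.

Lemma agree_sym n x y : agree n x y -> agree n y x.
Proof. by move=> xy i ni; rewrite xy. Qed.

Lemma agree_trans n x y z : agree n x y -> agree n y z -> agree n x z.
Proof. by move=> xy yz i ni; rewrite xy // yz. Qed.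

Lemma agreeW m n x y : (m <= n)%N -> agree n x y -> agree m x y.
Proof. by move=> mn xy i im; apply: xy; exact: leq_trans im mn. Qed.

Lemma nbhs_coord (x : cantor_space) i : \forall y \near x, y i = x i.
Proof.
have := @proj_continuous nat (fun=> bool) i x [set x i].
by apply; exact: discrete_set1.
Qed.

Lemma nbhs_cantor (x : cantor_space) (A : set cantor_space) :
  nbhs x A <-> exists n, forall y, agree n x y -> A y.
Proof.
split=> [xA|[n nA]].
  pose FF : set_system cantor_space := [set A | exists n, forall y, agree n x y -> A y].
  have Filt : Filter FF.
    split; first by exists 0%N.
      move=> B C [n nB] [m mC]; exists (maxn n m) => y xy; split.
        by apply: nB; apply: agreeW xy; rewrite leq_maxl.
      by apply: mC; apply: agreeW xy; rewrite leq_maxr.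
    by move=> B C BC [n nB]; exists n => y /nB /BC.
  suff : FF --> (x : {ptws nat -> bool}) by move=> /(_ A xA).
  apply: ptws_cvg => i U Ui; exists i.+1 => y xy.
  by rewrite -xy //; exact: nbhs_singleton.
have : \forall y \near x, forall i : 'I_n, y (nat_of_ord i) = x (nat_of_ord i).
  exact: (@filter_forall _ _ (fun i : 'I_n => [set y : cantor_space | y i = x i])
    (nbhs x) _ (fun i => nbhs_coord x i)).
apply: filterS => y yx; apply: nA => i ni.
by rewrite (yx (Ordinal ni)).
Qed.

Lemma loc_constant_modulus (T : Type) (p : cantor_space -> T) :
  (forall x, \forall y \near x, p y = p x) ->
  exists m, forall x y, agree m x y -> p x = p y.
Proof.
move=> ploc; have /compact_near_coveringP nc := cantor_space_compact.
have [x _|m _ mP] := nc nat \oo (fun m x => forall y, agree m x y -> p x = p y) _.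
  have /nbhs_cantor[n nP] := ploc x.
  exists ([set x' | agree n x x'], [set m | (n <= m)%N]).
    by split=> /=; [apply/nbhs_cantor; exists n | exact: nbhs_infty_ge].
  move=> [x' m] [/= xx' nm] y x'y; rewrite (nP _ xx') nP //.
  exact: agree_trans xx' (agreeW nm x'y).
by exists m => x y xy; apply: (mP m (leqnn m) x I).
Qed.

Definition ucont (f : cantor_space -> cantor_space) :=
  forall n, exists m, forall x y, agree m x y -> agree n (f x) (f y).

Lemma ucontP (f : cantor_space -> cantor_space) : continuous f <-> ucont f.
Proof.
split=> [fc n|fu x A /nbhs_cantor[n nA]].
  have [x|m mP] := @loc_constant_modulus _ (fun x => [seq f x i | i <- iota 0 n]).
    have : \forall y \near x, agree n (f x) (f y).
      by apply: (fc x [set z | agree n (f x) z]); apply/nbhs_cantor; exists n.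
    apply: filterS => y fxy; apply/eq_in_map => i; rewrite mem_iota add0n => ni.
    by rewrite fxy.
  exists m => x y /mP /eq_in_map fxy i ni; apply: fxy.
  by rewrite mem_iota add0n.
have [m mP] := fu n; apply/nbhs_cantor; exists m => y xy /=.
by apply: nA; exact: mP.
Qed.

Lemma ucont_comp f g : ucont f -> ucont g -> ucont (f \o g).
Proof.
move=> fu gu n; have [m mP] := fu n; have [l lP] := gu m.
by exists l => x y /lP /mP.
Qed.

Definition scons (b : bool) (x : cantor_space) : cantor_space :=
  fun i => if i is j.+1 then x j else b.
Definition stail (x : cantor_space) : cantor_space := fun i => x i.+1.

Lemma stailK x : scons (x 0%N) (stail x) = x.
Proof. by apply: funext => -[]. Qed.

Lemma ucont_scons b : ucont (scons b).
Proof. by case=> [|n]; [exists 0%N | exists n => x y xy [|i] // /xy]. Qed.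

Lemma ucont_stail : ucont stail.
Proof. by move=> n; exists n.+1 => x y xy i ni; apply: xy. Qed.

(** Gluing along a finite clopen partition: the maximum of the finitely many moduli works. *)
Lemma ucont_pieces (X : finType) (p : cantor_space -> X) (m : nat)
    (f : X -> cantor_space -> cantor_space) :
  (forall x y, agree m x y -> p x = p y) -> (forall a, ucont (f a)) ->
  ucont (fun x => f (p x) x).
Proof.
move=> pm fu n; have [k kP] := choice (fun a => fu a n).
exists (maxn m (\max_a k a)) => x y xy.
rewrite -(pm x y); last by apply: agreeW xy; rewrite leq_maxl.
apply: kP; apply: agreeW xy; rewrite leq_max; apply/orP; right.
exact: (leq_bigmax (F := k)).
Qed.

(* By induction on [m], splitting along the first coordinate. *)
Lemma clopen_chart (m : nat) (A : set cantor_space) : A !=set0 ->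
  (forall x y, agree m x y -> A x -> A y) ->
  exists f k, [/\ ucont f, ucont k, forall x, A (f x), cancel f k &
    forall x, A x -> f (k x) = x].
Proof.
have uid : ucont id by move=> n; exists n.
elim: m A => [|m IH] A [x0 Ax0] Am.
  exists id, id; split=> // x; first by apply: Am Ax0.
pose B b := [set w | A (scons b w)].
have Bm b x y : agree m x y -> B b x -> B b y.
  by move=> xy; apply: Am => -[|i] // /xy.
have head1 (x y : cantor_space) : agree 1 x y -> x 0%N = y 0%N by move=> ->.
(* If one half is empty, the first coordinate is forced and is stripped off; otherwise the charts of
   both halves are glued, keeping that coordinate. *)
have [[b B0]|/forallNP Bne] := pselect (exists b, ~ (B b !=set0)).
  have Bb : B (~~ b) !=set0.
    exists (stail x0); rewrite /B /=; suff -> : ~~ b = x0 0%N by rewrite stailK.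
    apply/eqP/negPn/negP => bx0; apply: B0; exists (stail x0); rewrite /B /=.
    have -> : b = x0 0%N by move: bx0; case: (b); case: (x0 0%N).
    by rewrite stailK.
  have [f [k [fu ku fB fk kf]]] := IH _ Bb (Bm (~~ b)).
  exists (scons (~~ b) \o f), (k \o stail); split=> //.
  - exact: ucont_comp (ucont_scons _) fu.
  - exact: ucont_comp ku ucont_stail.
  move=> x Ax /=; have xb : x 0%N = ~~ b.
    apply/eqP/negPn/negP => xb; apply: B0; exists (stail x).
    rewrite /B /=; have -> : b = x 0%N by move: xb; case: (b); case: (x 0%N).
    by rewrite stailK.
  by rewrite kf -?xb ?stailK // /B /= stailK.
have /choice[fk fkP] : forall b, exists fk : (cantor_space -> cantor_space) * (cantor_space -> cantor_space),
    [/\ ucont fk.1, ucont fk.2, forall x, B b (fk.1 x), cancel fk.1 fk.2 &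
      forall x, B b x -> fk.1 (fk.2 x) = x].
  move=> b; have Bb : B b !=set0 by apply: contrapT; exact: Bne.
  by have [f [k P]] := IH _ Bb (Bm b); exists (f, k).
exists (fun x => scons (x 0%N) ((fk (x 0%N)).1 (stail x))),
  (fun x => scons (x 0%N) ((fk (x 0%N)).2 (stail x))); split.
- apply: (@ucont_pieces bool (fun x => x 0%N) 1 (fun b x => scons b ((fk b).1 (stail x)))) => // b.
  apply: (ucont_comp (ucont_scons b)); apply: (ucont_comp _ ucont_stail).
  by have [] := fkP b.
- apply: (@ucont_pieces bool (fun x => x 0%N) 1 (fun b x => scons b ((fk b).2 (stail x)))) => // b.
  apply: (ucont_comp (ucont_scons b)); apply: (ucont_comp _ ucont_stail).
  by have [] := fkP b.
- by move=> x; have [_ _ + _ _] := fkP (x 0%N); apply.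
- move=> x; have [_ _ _ fK _] := fkP (x 0%N).
  by rewrite -[RHS]stailK -[stail x in RHS]fK.
- move=> x Ax; have [_ _ _ _ kf] := fkP (x 0%N).
  by rewrite -[RHS]stailK -[stail x in RHS]kf // /B /= stailK.
Qed.

(** * The homeomorphism group and its clopen partitions *)

Definition homeo_fun (h : Homeo) : cantor_space -> cantor_space := sval h.

Lemma homeo_eq (g h : Homeo) : (forall x, homeo_fun g x = homeo_fun h x) -> g = h.
Proof.
move=> gh; apply: eq_sig_hprop; first by move=> *; exact: Prop_irrelevance.
exact: funext.
Qed.

Lemma homeo_inv_subproof (h : Homeo) : exists k : cantor_space -> cantor_space,
  [/\ continuous k, cancel (homeo_fun h) k & cancel k (homeo_fun h)].
Proof. by have [_] := set_mem (svalP h). Qed.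

Definition homeo_inv (h : Homeo) := projT1 (cid (homeo_inv_subproof h)).

Lemma homeo_invP (h : Homeo) : [/\ continuous (homeo_inv h),
  cancel (homeo_fun h) (homeo_inv h) & cancel (homeo_inv h) (homeo_fun h)].
Proof. exact: projT2 (cid (homeo_inv_subproof h)). Qed.

Lemma homeo_funK h : cancel (homeo_fun h) (homeo_inv h).
Proof. by have [] := homeo_invP h. Qed.

Lemma homeo_invK h : cancel (homeo_inv h) (homeo_fun h).
Proof. by have [] := homeo_invP h. Qed.

Lemma homeo_inv_mul g h x :
  homeo_inv (homeo_mul g h) x = homeo_inv h (homeo_inv g x).
Proof.
apply: (can_inj (homeo_funK (homeo_mul g h))); rewrite homeo_invK.
by rewrite -[RHS]/(homeo_fun g (homeo_fun h _)) !homeo_invK.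
Qed.

Lemma homeo_exists f k : ucont f -> ucont k -> cancel f k -> cancel k f ->
  exists h : Homeo, homeo_fun h = f.
Proof.
move=> /ucontP fc /ucontP kc fk kf.
have fP : homeo_set (f : {compact-open, cantor_space -> cantor_space}).
  by split=> //; exists k.
by exists (exist (fun x => x \in homeo_set) _ (mem_set fP)).
Qed.

(** All pieces of both partitions are nonempty and clopen, hence copies of the Cantor space by
    [clopen_chart]; pieces of equal label are matched and the maps glued. *)
Lemma homeo_match (X : finType) (p q : cantor_space -> X) (m n : nat) :
  (forall x y, agree m x y -> p x = p y) -> (forall a, exists x, p x = a) ->
  (forall x y, agree n x y -> q x = q y) -> (forall a, exists x, q x = a) ->
  exists h : Homeo, forall x, q (homeo_fun h x) = p x.
Proof.
have charts (r : cantor_space -> X) l :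
    (forall x y, agree l x y -> r x = r y) -> (forall a, exists x, r x = a) ->
    exists fk : X -> (cantor_space -> cantor_space) * (cantor_space -> cantor_space),
    forall a, [/\ ucont (fk a).1, ucont (fk a).2, forall x, r ((fk a).1 x) = a,
      cancel (fk a).1 (fk a).2 & forall x, r x = a -> (fk a).1 ((fk a).2 x) = x].
  move=> rl ronto.
  suff /choice[fk fkP] : forall a, exists fk : (cantor_space -> cantor_space) *
      (cantor_space -> cantor_space), [/\ ucont fk.1, ucont fk.2,
      forall x, r (fk.1 x) = a, cancel fk.1 fk.2 & forall x, r x = a -> fk.1 (fk.2 x) = x].
    by exists fk.
  move=> a; have [x y|f [k P]] := @clopen_chart l [set x | r x = a] (ronto a).
    by move=> /rl /= ->.
  by exists (f, k).
move=> pm ponto qn qonto.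
have [f fP] := charts p m pm ponto; have [g gP] := charts q n qn qonto.
have [h hE] : exists h : Homeo,
    homeo_fun h = fun x => (g (p x)).1 ((f (p x)).2 x).
  apply: (@homeo_exists _ (fun x => (f (q x)).1 ((g (q x)).2 x))).
  - apply: (@ucont_pieces X p m (fun a x => (g a).1 ((f a).2 x))) => // a.
    by apply: (@ucont_comp (g a).1); [have [] := gP a | have [] := fP a].
  - apply: (@ucont_pieces X q n (fun a x => (f a).1 ((g a).2 x))) => // a.
    by apply: (@ucont_comp (f a).1); [have [] := fP a | have [] := gP a].
  - move=> x; have [_ _ qg gK _] := gP (p x); have [_ _ _ _ kf] := fP (p x).
    by rewrite qg gK kf.
  - move=> x; have [_ _ pf fK _] := fP (q x); have [_ _ _ _ kg] := gP (q x).
    by rewrite pf fK kg.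
exists h => x; rewrite hE; have [_ _ + _ _] := gP (p x); exact.
Qed.

Lemma homeo_mulA : associative homeo_mul.
Proof. by move=> x y z; apply: homeo_eq. Qed.

Lemma homeo_mul1g : left_id homeo_id homeo_mul.
Proof. by move=> x; apply: homeo_eq. Qed.

Lemma homeo_mulg1 : right_id homeo_id homeo_mul.
Proof. by move=> x; apply: homeo_eq. Qed.

Definition prefix (n : nat) (x : cantor_space) : {ffun 'I_n -> bool} :=
  [ffun i => x (nat_of_ord i)].

Lemma prefixP n x y : agree n x y <-> prefix n x = prefix n y.
Proof.
split=> [xy|/ffunP xy i ni]; first by apply/ffunP => i; rewrite !ffunE xy.
by have := xy (Ordinal ni); rewrite !ffunE.
Qed.

Lemma prefix_onto n t : exists x, prefix n x = t.
Proof.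
exists (fun i => if insub i is Some j then t j else false).
by apply/ffunP => j; rewrite ffunE valK.
Qed.

(** The trace records the partition into images of cylinders under [g], hence the inverse. Length
    [n.+1] ensures that the first coordinate is always recorded. *)
Definition homeo_trace (n : nat) (g : Homeo) (x : cantor_space) : {ffun 'I_n.+1 -> bool} :=
  prefix n.+1 (homeo_inv g x).

Lemma homeo_trace_base (W : set Homeo) : nbhs homeo_id W -> exists n,
  forall g g', homeo_trace n g = homeo_trace n g' ->
  exists2 u, W u & g' = homeo_mul g u.
Proof.
move=> /nbhs_set_type[V V1 VW].
have [n nV] : exists n, forall u : Homeo,
    (forall x, agree n x (homeo_fun u x)) -> V (sval u).
  pose FF : set_system {compact-open, cantor_space -> cantor_space} :=
    [set A | exists n, forall u : Homeo, (forall x, agree n x (homeo_fun u x)) -> A (sval u)].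
  have Filt : Filter FF.
    split; first by exists 0%N.
      move=> A B [n nA] [m mB]; exists (maxn n m) => u un; split.
        by apply: nA => x; apply: agreeW (un x); rewrite leq_maxl.
      by apply: mB => x; apply: agreeW (un x); rewrite leq_maxr.
    by move=> A B AB [n nA]; exists n => u /nA /AB.
  suff : FF --> (sval homeo_id) by move=> /(_ V V1).
  apply/compact_open_cvgP => K O /compact_near_coveringP cK oO KO.
  have [x Kx|m _ mP] := cK nat \oo (fun m x => forall y, agree m x y -> O y) _.
    have /nbhs_cantor[n nO] : nbhs x O.
      by apply: open_nbhs_nbhs; split=> //; apply: KO; exists x.
    exists ([set x' | agree n x x'], [set m | (n <= m)%N]).
      by split=> /=; [apply/nbhs_cantor; exists n | exact: nbhs_infty_ge].
    move=> [x' m] [/= xx' nm] y x'y; apply: nO.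
    exact: agree_trans xx' (agreeW nm x'y).
  by exists m => u uP _ [x Kx <-]; exact: (mP m (leqnn m) x Kx).
exists n => g g' gg'.
have [u uE] : exists u : Homeo, homeo_fun u = homeo_inv g \o homeo_fun g'.
  have [ig gK Kg] := homeo_invP g; have [ig' gK' Kg'] := homeo_invP g'.
  have cg := (set_mem (svalP g)).1; have cg' := (set_mem (svalP g')).1.
  apply: (@homeo_exists _ (homeo_inv g' \o homeo_fun g)).
  - by apply: ucont_comp; apply/ucontP.
  - by apply: ucont_comp; apply/ucontP.
  - by move=> x /=; rewrite Kg gK'.
  - by move=> x /=; rewrite Kg' gK.
exists u; last first.
  apply: homeo_eq => x; rewrite -[RHS]/(homeo_fun g (homeo_fun u x)) uE /=.
  by rewrite homeo_invK.
apply: VW; apply: nV => x; rewrite uE /=.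
have := congr1 (@^~ (homeo_fun g' x)) gg'.
rewrite /homeo_trace homeo_funK => /prefixP; move/agree_sym.
exact: agreeW.
Qed.

(** * The parity test along a convergent sequence *)

Definition probe (j : nat) : cantor_space := fun i => (i < j)%N.

Definition hits (g : Homeo) (j : nat) : bool := ~~ homeo_inv g (probe j) 0%N.

(* Parity of the number of points of the convergent sequence [probe] in the
   image under [g] of the clopen set of sequences starting with [false]
   ([false] by convention when this number is infinite). *)
Definition homeo_test (g : Homeo) : bool :=
  `[< exists m, (forall j, (m <= j)%N -> hits g j = false) /\
        odd (\sum_(j < m) hits g j) >].

Lemma homeo_testE (g : Homeo) (m : nat) : (forall j, (m <= j)%N -> hits g j = false) ->
  homeo_test g = odd (\sum_(j < m) hits g j).
Proof.
move=> gm.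
have ext K l : (forall j, (K <= j)%N -> hits g j = false) ->
    (\sum_(j < K) hits g j = \sum_(j < K + l) hits g j)%N.
  move=> gK; rewrite big_split_ord /= [X in (_ + X)%N]big1 ?addn0 // => i _.
  by rewrite gK // leq_addr.
apply/asboolP/idP => [[m' [gm']]|om]; last by exists m.
by rewrite (ext _ m gm') (ext _ m' gm) addnC.
Qed.

(** Compact-open closeness makes [g'] and [g] carry both clopen pieces of the partition [p] to the
    same sets; all hits then agree, whatever the left factor [a]. *)
Lemma homeo_test_loc (g x : Homeo) : \forall g' \near g, forall a,
  homeo_test (homeo_mul a (homeo_mul g' x)) = homeo_test (homeo_mul a (homeo_mul g x)).
Proof.
pose p y := homeo_inv x y 0%N.
have p_loc y : \forall y' \near y, p y' = p y.
  have [xc _ _] := homeo_invP x.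
  by apply: (xc y [set z | z 0%N = p y]); exact: nbhs_coord.
have open_p b (f : cantor_space -> cantor_space) :
    continuous f -> open [set y | p (f y) = b].
  move=> fc; apply: (@open_comp _ _ f [set y | p y = b]) => [y _|]; first exact: fc.
  rewrite openE => y /= <-; exact: p_loc.
have near_b b : \forall g' \near g, forall y, p y = b -> p (homeo_inv g (homeo_fun g' y)) = b.
  pose K := [set y | p y = b]; pose O := [set z | p (homeo_inv g z) = b].
  have cK : compact K.
    apply: (@subclosed_compact _ _ setT) => //; last exact: cantor_space_compact.
    have -> : K = ~` [set y | p y = ~~ b].
      by apply/seteqP; split=> y; rewrite /K /=; case: (p y) (b) => -[].
    exact: open_closedC (open_p _ _ (fun y => cvg_id)).
  have oO : open O by apply: open_p; have [] := homeo_invP g.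
  apply/nbhs_set_type; exists [set f : {compact-open, cantor_space -> cantor_space} | f @` K `<=` O].
    apply: open_nbhs_nbhs; split; first exact: compact_open_open.
    by move=> _ [y Ky <-]; rewrite /O /= -/(homeo_fun g y) homeo_funK.
  by move=> g' g'K y py; apply: g'K; exists y.
have := near_b false; have := near_b true; apply: filterS2 => g' g't g'f a.
suff hE : hits (homeo_mul a (homeo_mul g' x)) = hits (homeo_mul a (homeo_mul g x)).
  by rewrite /homeo_test hE.
apply: funext => j; rewrite /hits !homeo_inv_mul; set z := homeo_inv a _.
have := homeo_invK g' z; set y := homeo_inv g' z => yz.
rewrite -/(p y) -/(p (homeo_inv g z)) -yz.
by case E : (p y); [rewrite g't | rewrite g'f].
Qed.

(** Pieces are indexed by the position of the first [false], cut off at [N]. Piece [z < N] contains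
    exactly the probe [z], and the last piece all probes from [N] on. *)
Definition part (N : nat) (x : cantor_space) : 'I_N.+1 :=
  inord (find (fun i => ~~ x i) (iota 0 N)).

Lemma part_agree N x y : agree N x y -> part N x = part N y.
Proof.
move=> xy; congr inord; apply: eq_in_find => i.
by rewrite mem_iota add0n => iN; rewrite xy.
Qed.

Lemma part_probe N j : part N (probe j) = inord (minn j N).
Proof.
congr inord; have [jN|Nj] := leqP j N.
  have -> : iota 0 N = iota 0 j ++ iota j (N - j) by rewrite -iotaD subnKC.
  rewrite find_cat size_iota; case: hasP => [[i]|_].
    by rewrite mem_iota add0n /probe /= => ->.
  case E : (N - j)%N => [|l] /=; first by rewrite addn0.
  by rewrite /probe ltnn addn0.
rewrite hasNfind ?size_iota //; apply/hasPn => i; rewrite mem_iota add0n /= negbK.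
by move=> iN; exact: ltn_trans iN Nj.
Qed.

Lemma part_onto N (z : 'I_N.+1) : part N (probe z) = z.
Proof.
rewrite part_probe; have := ltn_ord z; rewrite ltnS => /minn_idPl ->.
exact: inord_val.
Qed.

(** Greedy choice of distinct representatives; the strict bound leaves room to avoid [z0] as
    well. *)
Lemma distinct_selection (Z : finType) (z0 : Z) (s : seq {set Z}) :
  (forall B, B \in s -> size s < #|B|)%N ->
  exists b : seq Z, [/\ size b = size s, uniq b, z0 \notin b &
    forall i, (i < size s)%N -> nth z0 b i \in nth finset.set0 s i].
Proof.
elim: s => [|B s IH] sB; first by exists [::].
have [|b [sb ub zb bs]] := IH.
  by move=> C Cs; apply: leq_ltn_trans (sB C _) => //; rewrite inE Cs orbT.
have [v vB vb] : exists2 v, v \in B & v \notin z0 :: b.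
  apply/exists_inP; rewrite -[X in is_true X]negbK negb_exists_in.
  apply/negP => /forall_inP Bb; have := sB B (mem_head _ _).
  rewrite ltnNge => /negP; apply; rewrite /= -sb -[(size b).+1]/(size (z0 :: b)).
  apply: leq_trans (card_size _); apply: subset_leq_card.
  by apply/fintype.subsetP => v /Bb; rewrite negbK.
move: vb; rewrite inE negb_or => /andP[vz vb].
exists (v :: b); split; rewrite /= ?sb ?vb // ?inE ?negb_or 1?eq_sym ?vz //.
by case=> [|i] //; rewrite ltnS => /bs.
Qed.

(** * Clopen labellings and their realization by homeomorphisms *)

Section CantorLabels.
Variables (n N : nat).
Local Notation X := {ffun 'I_n.+1 -> bool}.
Local Notation Z := 'I_N.+1.

Definition inside (t : X) : bool := ~~ t ord0.

(** Surjectivity makes the labelling realizable by [homeo_match]. The condition at [ord_max] leaves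
    only finitely many hits, so that the parity is meaningful. *)
Definition clopen_labels : set (Z -> X) :=
  [set phi | (forall t, exists z, phi z = t) /\ ~~ inside (phi ord_max)].

Lemma clopen_labels_realized : exists real : (Z -> X) -> Homeo,
  forall phi, clopen_labels phi ->
  forall x, prefix n.+1 (homeo_inv (real phi) x) = phi (part N x).
Proof.
suff /choice[real realP] : forall phi : Z -> X, exists h : Homeo, clopen_labels phi ->
    forall x, prefix n.+1 (homeo_inv h x) = phi (part N x) by exists real.
move=> phi; have [[onto _]|no] := pselect (clopen_labels phi); last first.
  by exists homeo_id => /no.
have [||||h hP] := @homeo_match X (prefix n.+1) (phi \o part N) n.+1 N.
- by move=> x y /prefixP.
- exact: prefix_onto.
- by move=> x y /part_agree /= ->.
- move=> t; have [z zt] := onto t; exists (probe z).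
  by rewrite /= part_onto.
by exists h => _ x; rewrite -hP /= homeo_invK.
Qed.

Lemma homeo_test_label (g : Homeo) (phi : Z -> X) : clopen_labels phi ->
  (forall x, prefix n.+1 (homeo_inv g x) = phi (part N x)) ->
  homeo_test g = odd (\sum_(z : Z) inside (phi z)).
Proof.
move=> [_ out] gP.
have hitsE j : hits g j = inside (phi (inord (minn j N))).
  by rewrite -part_probe -gP /inside ffunE.
rewrite (@homeo_testE _ N) => [|j Nj].
  rewrite [in RHS]big_ord_recr /= (negPf out) addn0; congr odd.
  apply: eq_bigr => i _; rewrite hitsE; congr (inside (phi _)).
  apply: val_inj => /=; rewrite inordK (minn_idPl (ltnW (ltn_ord i))) //.
  exact: leqW (ltn_ord i).
rewrite hitsE (minn_idPr Nj) (_ : inord N = ord_max) ?(negPf out) //.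
by apply: val_inj; rewrite /= inordK.
Qed.

(** Distinct places, one in [S i] for each pair [(i, t)], carry the label [t], which makes every
    [S i] meet all labels. Relabelling one place [j0] outside all [S i] then flips the parity. *)
Lemma clopen_labels_separate (I : finType) (i0 : I) (J : nat) (S : I -> {set Z}) :
  ((#|I| * #|{: X}|).+1 < J)%N -> (#|I| * J < N)%N ->
  (forall i, #|S i| = J) ->
  exists phi phi' : Z -> X,
    [/\ clopen_labels phi, clopen_labels phi',
        odd (\sum_(z : Z) inside (phi z)) != odd (\sum_(z : Z) inside (phi' z)),
        forall i z, z \in S i -> phi z = phi' z &
        forall i t, exists2 z, z \in S i & phi z = t].
Proof.
move=> KJ JN SJ; pose K := enum {: I * X}.
have sK : size K = (#|I| * #|{: X}|)%N by rewrite -cardE card_prod.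
have [B|b [sb ub zb bS]] := @distinct_selection Z ord_max [seq S p.1 | p <- K].
  by case/mapP => p _ ->; rewrite size_map sK SJ ltnW.
rewrite size_map in sb bS.
have [j0 j0N] : exists j0 : Z, j0 \notin ord_max :: flatten [seq enum (S i) | i <- enum I].
  apply/existsP; rewrite -[X in is_true X]negbK negb_exists; apply/negP => /forallP allZ.
  suff : (#|{: Z}| <= (#|I| * J).+1)%N by rewrite card_ord ltnS leqNgt JN.
  have <- : size (ord_max :: flatten [seq enum (S i) | i <- enum I]) = (#|I| * J).+1.
    rewrite /= size_flatten /shape -map_comp sumnE big_map big_enum /=.
    by rewrite (eq_bigr (fun=> J)) => [|i _]; rewrite ?sum_nat_const // -cardE SJ.
  apply: leq_trans (card_size _); apply: subset_leq_card.
  by apply/fintype.subsetP => z _; have := allZ z; rewrite negbK.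
have j0S i : j0 \notin S i.
  apply: contra j0N => j0i; rewrite inE; apply/orP; right.
  by apply/flatten_mapP; exists i; rewrite mem_enum.
have j0m : j0 != ord_max by move: j0N; rewrite inE negb_or => /andP[].
have ixK i t : (index (i, t) K < size K)%N by rewrite index_mem mem_enum.
have bE k : (k < size K)%N -> exists i, nth ord_max b k \in S i.
  move=> kK; pose p : I * X := (i0, [ffun=> true]).
  by exists (nth p K k).1; have := bS k kK; rewrite (nth_map p).
have j0b : j0 \notin b.
  apply/negP => /(nthP ord_max)[k]; rewrite sb => /bE[i ki] kj0.
  by move: (j0S i); rewrite -kj0 ki.
pose t1 : X := [ffun=> true]; pose t0 : X := [ffun=> false].
pose phi z : X := if z \in b then nth t1 (map snd K) (index z b) else t1.
pose phi' z : X := if z == j0 then t0 else phi z.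
have phi_j0 : phi j0 = t1 by rewrite /phi (negPf j0b).
have phi'E i z : z \in S i -> phi z = phi' z.
  by rewrite /phi'; case: eqP => // -> j0i; move: (j0S i); rewrite j0i.
have onto i t : exists2 z, z \in S i & phi z = t.
  exists (nth ord_max b (index (i, t) K)).
    have := bS _ (ixK i t); rewrite (nth_map (i, t)) //.
    by rewrite nth_index // mem_enum.
  rewrite /phi mem_nth ?sb // index_uniq ?sb // (nth_map (i, t)) //.
  by rewrite nth_index // mem_enum.
have out1 : ~~ inside t1 by rewrite /inside ffunE.
have in0 : inside t0 by rewrite /inside ffunE.
exists phi, phi'; split=> //.
- split; first by move=> t; have [z _ zt] := onto i0 t; exists z.
  by rewrite /phi (negPf zb).
- split; last by rewrite /phi' eq_sym (negPf j0m) /phi (negPf zb).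
  by move=> t; have [z zS zt] := onto i0 t; exists z; rewrite -(phi'E i0).
- rewrite (bigD1 j0) //= [in X in _ != X](bigD1 j0) //= phi_j0 (negPf out1).
  rewrite /phi' eqxx in0 add0n oddD /=.
  have -> : (\sum_(z | z != j0) inside (if z == j0 then t0 else phi z) =
      \sum_(z | z != j0) inside (phi z))%N.
    by apply: eq_bigr => z /negPf->.
  by case: (odd _).
Qed.

End CantorLabels.

Lemma homeo_traces_modulus (N : nat) (A : set Homeo) : finite_set A ->
  exists m, forall a, A a -> forall x y, agree m x y ->
    part N (homeo_inv a x) = part N (homeo_inv a y).
Proof.
move=> /finite_seqP[s ->].
have mod a : exists m, forall x y, agree m x y ->
    part N (homeo_inv a x) = part N (homeo_inv a y).
  have [/ucontP /(_ N)[m mP] _ _] := homeo_invP a.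
  by exists m => x y /mP /part_agree.
have [k kP] := choice mod.
exists (\max_(a <- s) k a)%N => a /= sa x y xy; apply: kP; apply: agreeW xy.
exact: (leq_bigmax_seq (F := k)).
Qed.

Lemma homeo_outcolours : outcolours homeo_mul homeo_test homeo_trace.
Proof.
apply: outcolours_of_labels => n I i0.
pose X : finType := {ffun 'I_n.+1 -> bool}.
pose J := (#|I| * #|X|).+2; pose N := (#|I| * J).+1.
have [real realP] := clopen_labels_realized n N.
exists X, 'I_N.+1, [ffun=> true], real, (@clopen_labels n N), J; split.
- have I0 : (0 < #|I|)%N by apply/card_gt0P; exists i0.
  by rewrite card_ord; apply/leqW/leqW; exact: leq_pmull.
- move=> S SJ; have [phi [phi' [Hphi Hphi' odd_neq phiE onto]]] :=
    clopen_labels_separate i0 (ltnSn _) (ltnSn _) SJ.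
  exists phi, phi'; split=> //.
  rewrite (homeo_test_label Hphi (realP _ Hphi)).
  by rewrite (homeo_test_label Hphi' (realP _ Hphi')).
move=> E finE; have [m mP] := homeo_traces_modulus N finE.
pose M : finType := {ffun 'I_m -> bool}.
have [ext extP] := choice (@prefix_onto m).
have ext_agree x : agree m x (ext (prefix m x)) by apply/prefixP; rewrite extP.
(* The letters enumerate the cylinders of length [m]; seen from [a], each lies over the part
   containing its preimage under [a], well defined by the choice of [m]. *)
exists #|M|, (fun a p => part N (homeo_inv a (ext (enum_val p)))); split.
  move=> a z Ea; exists (enum_rank (prefix m (homeo_fun a (probe z)))).
  rewrite enum_rankK -(mP a Ea (homeo_fun a (probe z))) //.
  by rewrite homeo_funK part_onto.
(* A word containing every letter is nonempty, so its length can be taken as [L.+1], the number of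
   pieces of [part L]. *)
case=> [|L].
  exists (fun _ _ => [ffun=> true]) => -[|//] _ /(_ (enum_rank [ffun=> true])).
  by rewrite in_nil.
exists (fun s x => nth [ffun=> true] s (part L x)) => W sW onW.
pose w0 : 'I_#|M| := enum_rank [ffun=> true].
(* [g] carries each cylinder to the union of the pieces of [part L] at which [W] has the
   corresponding letter. *)
pose q x : M := enum_val (nth w0 W (part L x)).
have [||||g gP] := @homeo_match M (prefix m) q m L.
- by move=> x y /prefixP.
- exact: prefix_onto.
- by move=> x y /part_agree xy; rewrite /q xy.
- move=> t; have /(nthP w0)[l lW Wl] := onW (enum_rank t).
  have lL : (l < L.+1)%N by rewrite -sW.
  by exists (probe (Ordinal lL)); rewrite /q part_onto /= Wl enum_rankK.
exists g => a phi Ea Hphi; apply: funext => x.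
rewrite /homeo_trace !homeo_inv_mul realP // (nth_map w0) ?sW //.
congr phi; have := gP (homeo_inv g x); rewrite homeo_invK /q => ->.
exact: mP.
Qed.

Lemma homeo_S_not_iso_EM (R : realType) : S_not_iso_EM homeo_mul homeo_id.
Proof.
exact: (S_not_iso_EM_criterion R homeo_mulA homeo_mul1g homeo_mulg1
  homeo_test_loc homeo_trace_base homeo_outcolours).
Qed.

Theorem mainTheorem13 :
  S_not_iso_EM homeo_mul homeo_id /\
  (forall F : finFieldType, S_not_iso_EM (@aut_mul F) (@aut_id F)).
Proof.
(* The real field only hosts the Urysohn functions of the proof; a concrete model is supplied
   here. *)
split; first exact: homeo_S_not_iso_EM Rdefinitions.R.
exact: aut_S_not_iso_EM Rdefinitions.R.
Qed.
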